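(* Let $\mathcal I=((H_n)_{n\in\mathbb N_0},a^* )$ be an interacting Fock space based on a pre-Hilbert space $H$ and embedded via a Fock isometry $\xi\colon\mathcal I\to\overline{\mathscr F(H)}$. Let $\mathcal D_{\xi^*}:=\xi\mathcal I\oplus(\xi\mathcal I)^\perp\subset\overline{\mathscr F(H)}$ and let $\xi^*\colon\mathcal D_{\xi^*}\to\mathcal I$ be the adjoint of $\xi$. There exists a unique linear map $\varkappa\in\mathscr L((H\otimes\mathcal D_{\xi^*})\oplus\mathbb C\Omega,\mathcal D_{\xi^*})$ with $\varkappa\Omega=\Omega$ (necessarily also a Fock map) such that $$\varkappa\,\ell^*(x)=\xi a^*(x)\xi^*\qquad\text{for all }x\in H .$$ Therefore, the algebra monomorphism $\mathscr L(\mathcal I)\to\mathscr L(\mathcal D_{\xi^*})$, $a\mapsto\xi a\xi^*$, sends $a^*(x)$ to $\varkappa\ell^*(x)$. If $a^*(x)$ has an adjoint $a(x)\in\mathscr L(\mathcal I)$, then $\xi a(x)\xi^*=(\varkappa\ell^*(x))^*$ (though $\varkappa$ need not be adjointable). In either case, this ($*$-)monomorphism respects the vacuum state: $\langle\Omega,\xi a\xi^*\Omega\rangle=\langle\Omega,a\Omega\rangle$. Moreover, $\lambda:=\xi\Lambda$ can be recovered as the unique Fock map satisfying $$\lambda=\varkappa\bigl((\mathrm{id}_H\otimes\lambda)\oplus\mathrm{id}_{\Omega\mathbb C}\bigr)$$ (using $\mathscr F(H)=(H\otimes\mathscr F(H))\oplus\Omega\mathbb C$), that is, as the unique $\lambda$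 whose components satisfy the recursion $\lambda_{n+1}=\varkappa_{n+1}(\mathrm{id}_H\otimes\lambda_n)$ and $\lambda_0=\mathrm{id}_{\mathbb C\Omega}$, that is, $$\lambda_n=\varkappa_n(\mathrm{id}_H\otimes\varkappa_{n-1})\cdots(\mathrm{id}_H^{\otimes(n-1)}\otimes\varkappa_1)\qquad(n\ge1).$$
   Context: All vector spaces are complex; direct sums and tensor products of pre-Hilbert spaces are algebraic; $\overline V$ is the completion of a pre-Hilbert space $V$; $\mathscr L(V,W)$ is the space of all linear maps $V\to W$, $\mathscr L(V)=\mathscr L(V,V)$. $\mathscr F(H)=\Omega\mathbb C\oplus\bigoplus_{n\ge1}H^{\otimes n}$ is the algebraic full Fock space with its natural inner product; $H^{\otimes 0}:=\Omega\mathbb C$. For $x\in H$, $\ell^*(x)$ is the (bounded) creation operator $X\mapsto x\otimes X$, $\ell^*(x)\Omega=x$, on $\mathscr F(H)$ and on $\overline{\mathscr F(H)}$. We identify $x\otimes\Omega=x$. For a subspace $\mathcal D\subset\overline{\mathscr F(H)}$, the spaces $H\otimes\mathcal D$ and $(H\otimes\mathcal D)\oplus\Omega\mathbb C$ are regarded as subspaces of $\overline{\mathscr F(H)}$. An interacting Fock space based on $H$ consists of pre-Hilbert spaces $H_n$ with $H_0=\Omega\mathbb C$ ($\Omega$ a unit vector), $\mathcal I=\bigoplus_nH_n$, and a linear map $a^*\colon H\to\mathscr L(\mathcal I)$ with $\operatorname{span}a^*(H)H_n=H_{n+1}$ for all $n$. $\Lambda\colon\mathscr F(H)\to\mathcal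 I$ is the linear map with $\Lambda\Omega=\Omega$, $\Lambda(x_n\otimes\dots\otimes x_1)=a^*(x_n)\cdots a^*(x_1)\Omega$. A Fock map is a linear map that preserves the vacuum ($\Omega\mapsto\Omega$) and is even, i.e. maps degree-$n$ elements to degree-$n$ elements for each $n$ (degree $n$ in $\mathcal I$: $H_n$; in a subspace of $\overline{\mathscr F(H)}$: its intersection with $\overline{H^{\otimes n}}$); its $n$-th component is denoted by the subscript $n$. A Fock isometry $\xi\colon\mathcal I\to\overline{\mathscr F(H)}$ is an isometry with $\xi\Omega=\Omega$, $\xi H_n\subset\overline{H^{\otimes n}}$. Its adjoint $\xi^*\colon\mathcal D_{\xi^*}=\xi\mathcal I\oplus(\xi\mathcal I)^\perp\to\mathcal I$ (complement in the Hilbert space $\overline{\mathscr F(H)}$) is given by $\xi^*\xi X=X$ and $\xi^*Y=0$ for $Y\in(\xi\mathcal I)^\perp$. The map $\lambda=\xi\Lambda$ has range $\xi\mathcal I\subset\mathcal D_{\xi^*}$; Fock maps $\lambda$ in the last assertion are maps $\mathscr F(H)\to\mathcal D_{\xi^*}$. *)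

(* Defs.v *)
From HB Require Import structures.
From mathcomp Require Import all_boot all_order all_algebra.
From mathcomp Require Import sesquilinear complex.
From mathcomp Require Import boolp classical_sets functions reals.
From mathcomp Require Import topology normedtype.
From mathcomp Require Import ring lra.
Set Implicit Arguments.
Unset Strict Implicit.
Unset Printing Implicit Defensive.
Import Order.TTheory GRing.Theory Num.Theory Num.Def.
Import numFieldNormedType.Exports.
Local Open Scope ring_scope.
Local Open Scope classical_set_scope.

(* As in [sesquilinear], inner products are linear in the first argument and
   conjugate-linear in the second one. *)
HB.mixin Record isPreHilbert (R : realType) V of GRing.Lmodule R[i] V := {
  dotp : {dot V for conjC}
}.

#[short(type="preHilbertType")]
HB.structure Definition PreHilbert (R : realType) :=
  {V of isPreHilbert R V & GRing.Lmodule R[i] V}.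

Notation "''[' x , y ]" := (dotp x y) : ring_scope.

Lemma sqrt_sum_le (R : rcfType) (u v : R) :
  Num.sqrt (u ^+ 2 + v ^+ 2) <= `|u| + `|v|.
Proof.
have uv0 : 0 <= `|u| + `|v| by rewrite addr_ge0.
rewrite -(ler_sqr _ uv0) ?nnegrE ?sqrtr_ge0 // sqr_sqrtr ?addr_ge0 ?sqr_ge0 //.
rewrite sqrrD !real_normK ?num_real // addrAC lerDl mulrn_wge0 //.
by rewrite mulr_ge0.
Qed.

Section ComplexLimits.
Variable R : realType.
Local Notation C := R[i].

Definition clim (z : nat -> C) (l : C) : Prop :=
  forall e : C, 0 < e -> exists N, forall n, (N <= n)%N -> `|z n - l| < e.

Definition ccauchy (z : nat -> C) : Prop :=
  forall e : C, 0 < e ->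
  exists N, forall m n, (N <= m)%N -> (N <= n)%N -> `|z m - z n| < e.

Lemma clim_cst (l : C) : clim (fun=> l) l.
Proof. by move=> e e0; exists 0%N => n _; rewrite subrr normr0. Qed.

Lemma climD z1 z2 l1 l2 :
  clim z1 l1 -> clim z2 l2 -> clim (fun n => z1 n + z2 n) (l1 + l2).
Proof.
move=> h1 h2 e e0; have e20 : 0 < e / 2%:R by rewrite divr_gt0 // ltr0n.
have [N1 H1] := h1 _ e20; have [N2 H2] := h2 _ e20.
exists (maxn N1 N2) => n; rewrite geq_max => /andP[n1 n2].
rewrite opprD addrACA (splitr e) (le_lt_trans (ler_normD _ _)) //.
by rewrite ltrD // ?H1 ?H2.
Qed.

Lemma climZ c z l : clim z l -> clim (fun n => c * z n) (c * l).
Proof.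
move=> h e e0; have c0 : 0 < `|c| + 1 by rewrite ltr_wpDl.
have [N HN] := h _ (divr_gt0 e0 c0); exists N => n Nn.
rewrite -mulrBr normrM; have := HN n Nn; rewrite ltr_pdivlMr // mulrC.
apply: le_lt_trans; rewrite mulrDl mul1r lerDl; exact: normr_ge0.
Qed.

Lemma climJ z l : clim z l -> clim (fun n => (z n)^*) l^*.
Proof.
by move=> h e /h[N HN]; exists N => n /HN; rewrite -rmorphB norm_conjC.
Qed.

Lemma clim_le0 z l (M : C) :
  clim z l -> (forall n, `|z n| <= M) -> `|l| <= M.
Proof.
move=> h hM; have M0 : 0 <= M by apply: le_trans (hM 0%N); apply: normr_ge0.
rewrite real_leNgt ?ger0_real //; apply/negP => lt.
have /h[N /(_ N (leqnn _))] : 0 < `|l| - M by rewrite subr_gt0.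
apply/negP; rewrite -real_leNgt ?rpredB ?ger0_real //.
rewrite lerBlDr (le_trans _ (lerD (lexx _) (hM N))) //.
by rewrite distrC (le_trans _ (ler_normD _ _)) // subrK.
Qed.

Lemma clim_uniq z l1 l2 : clim z l1 -> clim z l2 -> l1 = l2.
Proof.
move=> h1 h2; apply/eqP; rewrite -subr_eq0 -normr_le0.
have h : clim (fun=> 0) (l1 - l2).
  have := climD h1 (climZ (-1) h2); rewrite mulN1r.
  by under eq_fun do rewrite mulN1r subrr.
by apply: (clim_le0 h) => _; rewrite normr0.
Qed.

Lemma eq_clim z1 z2 l : z1 =1 z2 -> clim z1 l -> clim z2 l.
Proof. by move=> /funext ->. Qed.

Lemma clim_ge0 z l : clim z l -> (forall n, 0 <= z n) -> 0 <= l.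
Proof.
move=> h z0.
have lr : l^* = l.
  by apply: clim_uniq (climJ h) _; apply: eq_clim h => n; rewrite geC0_conj.
have {}lr : l \is Num.real by apply/CrealP.
rewrite real_leNgt // ?real0 //; apply/negP => l0.
have /h[N /(_ N (leqnn _))] : 0 < - l by rewrite oppr_gt0.
rewrite ger0_norm; last by rewrite addr_ge0 // oppr_ge0 ltW.
by rewrite gtrDr; apply/negP; rewrite -real_leNgt ?ger0_real ?real0.
Qed.

Let Re_lt (z e : C) : 0 < e -> `|z| < e -> `|complex.Re z| < complex.Re e.
Proof.
case: z => a b; case: e => x y; rewrite normc_def !ltcE /= => /andP[/eqP _ x0].
move=> /andP[_]; apply: le_lt_trans; rewrite -sqrtr_sqr ler_wsqrtr //.
by rewrite lerDl sqr_ge0.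
Qed.

Let Im_lt (z e : C) : 0 < e -> `|z| < e -> `|complex.Im z| < complex.Re e.
Proof.
case: z => a b; case: e => x y; rewrite normc_def !ltcE /= => /andP[/eqP _ x0].
move=> /andP[_]; apply: le_lt_trans; rewrite -sqrtr_sqr ler_wsqrtr //.
by rewrite lerDr sqr_ge0.
Qed.

Let real_complete (u : nat -> R) :
  (forall e : R, 0 < e -> exists N, forall m n, (N <= m)%N -> (N <= n)%N ->
     `|u m - u n| < e) ->
  exists l, forall e : R, 0 < e -> exists N, forall n, (N <= n)%N ->
     `|u n - l| < e.
Proof.
move=> hu.
have /cauchy_cvg : cauchy (u n @[n --> \oo]).
  apply/cauchyP => e e0; have [N HN] := hu _ e0; exists (u N).
  by exists N => // n /= Nn; apply: HN.
move=> /cvg_ex[l /cvgrPdist_lt hl]; exists l => e /hl[N _ HN].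
by exists N => n Nn; rewrite distrC; apply: HN.
Qed.

Lemma ccauchy_lim z : ccauchy z -> exists l, clim z l.
Proof.
move=> hz.
have ec (e : R) : 0 < e -> 0 < (e%:C)%C :> C by rewrite ltcE /= eqxx.
have [a Ha] : exists l : R, forall e : R, 0 < e -> exists N, forall n,
    (N <= n)%N -> `|complex.Re (z n) - l| < e.
  apply: real_complete => e e0; have [N HN] := hz _ (ec _ e0).
  exists N => m n Nm Nn; have := Re_lt (ec _ e0) (HN m n Nm Nn).
  by case: (z m) (z n) => ? ? [].
have [b Hb] : exists l : R, forall e : R, 0 < e -> exists N, forall n,
    (N <= n)%N -> `|complex.Im (z n) - l| < e.
  apply: real_complete => e e0; have [N HN] := hz _ (ec _ e0).
  exists N => m n Nm Nn; have := Im_lt (ec _ e0) (HN m n Nm Nn).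
  by case: (z m) (z n) => ? ? [].
exists (a +i* b)%C => -[x y]; rewrite ltcE /= => /andP[/eqP yE x0].
have x20 : 0 < x / 2%:R by rewrite divr_gt0 // ltr0n.
have [N1 H1] := Ha _ x20; have [N2 H2] := Hb _ x20.
exists (maxn N1 N2) => n; rewrite geq_max => /andP[/H1{}H1 /H2{}H2].
rewrite ltcE normc_def /= {}yE eqxx /=.
case: (z n) H1 H2 => p q /= H1 H2.
apply: (@le_lt_trans _ _ (`|p - a| + `|q - b|)); last first.
  by rewrite (splitr x) ltrD.
exact: sqrt_sum_le.
Qed.

End ComplexLimits.

Section PreHilbertTheory.
Variables (R : realType) (V : preHilbertType R).
Local Notation C := R[i].
Implicit Types (x y : V) (u w : nat -> V).

Definition hnorm x : C := sqrtC '[x, x].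

Definition hcauchy u : Prop :=
  forall e : C, 0 < e ->
  exists N, forall m n, (N <= m)%N -> (N <= n)%N -> hnorm (u m - u n) < e.

Definition hclosure (S : set V) : set V :=
  [set x | forall e : C, 0 < e -> exists2 y, S y & hnorm (x - y) < e].

Lemma dotJ x y : '[x, y] = ('[y, x])^*.
Proof. by rewrite hermC expr0 mul1r. Qed.

Lemma dotDl x y z : '[x + y, z] = '[x, z] + '[y, z].
Proof. exact: linearDl. Qed.
Lemma dotDr x y z : '[x, y + z] = '[x, y] + '[x, z].
Proof. exact: linearDr. Qed.
Lemma dotBl x y z : '[x - y, z] = '[x, z] - '[y, z].
Proof. exact: linearBl. Qed.
Lemma dotBr x y z : '[x, y - z] = '[x, y] - '[x, z].
Proof. exact: linearBr. Qed.
Lemma dotZl (c : C) x y : '[c *: x, y] = c * '[x, y].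
Proof. exact: linearZl_LR. Qed.
Lemma dotZr (c : C) x y : '[x, c *: y] = c^* * '[x, y].
Proof. exact: linearZr_LR. Qed.
Lemma dot0l x : '[0, x] = 0. Proof. exact: linear0l. Qed.
Lemma dot0r x : '[x, 0] = 0. Proof. exact: linear0r. Qed.

Lemma dot_suml I (r : seq I) (F : I -> V) y :
  '[\sum_(i <- r) F i, y] = \sum_(i <- r) '[F i, y].
Proof. exact: linear_sumlz. Qed.
Lemma dot_sumr I (r : seq I) (F : I -> V) y :
  '[y, \sum_(i <- r) F i] = \sum_(i <- r) '[y, F i].
Proof. exact: linear_sumr. Qed.

Lemma dot_ge0 x : 0 <= '[x, x]. Proof. exact: dnorm_ge0. Qed.

Lemma hnorm_ge0 x : 0 <= hnorm x.
Proof. by rewrite sqrtC_ge0 dot_ge0. Qed.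

Lemma hnormK x : hnorm x ^+ 2 = '[x, x].
Proof. by rewrite sqrtCK. Qed.

Lemma hnorm_eq0 x : (hnorm x == 0) = (x == 0).
Proof. by rewrite sqrtC_eq0 dnorm_eq0. Qed.

Lemma hnorm0 : hnorm 0 = 0. Proof. by apply/eqP; rewrite hnorm_eq0. Qed.

Lemma hnormZ (c : C) x : hnorm (c *: x) = `|c| * hnorm x.
Proof.
apply/eqP; rewrite -(eqrXn2 (n := 2)) ?hnorm_ge0 ?mulr_ge0 ?hnorm_ge0 //.
by rewrite exprMn !hnormK dotZl dotZr mulrA -normCK.
Qed.

Lemma hnormN x : hnorm (- x) = hnorm x.
Proof. by rewrite -scaleN1r hnormZ normrN1 mul1r. Qed.

Lemma hnormBC x y : hnorm (x - y) = hnorm (y - x).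
Proof. by rewrite -opprB hnormN. Qed.

Lemma dot_CS x y : `|'[x, y]| <= hnorm x * hnorm y.
Proof.
have [->|y0] := eqVneq y 0; first by rewrite dot0r normr0 hnorm0 mulr0.
have yy0 : 0 < '[y, y] by rewrite dnorm_gt0.
rewrite -(ler_pXn2r (n := 2)) ?nnegrE ?mulr_ge0 ?hnorm_ge0 // exprMn !hnormK.
have := dot_ge0 (x - ('[x, y] / '[y, y]) *: y).
rewrite dotBl !dotBr !dotZl !dotZr.
set a := '[x, y]; set b := '[y, y].
have bJ : b^* = b by rewrite -dotJ.
have b0 : b != 0 by rewrite gt_eqF.
rewrite rmorphM fmorphV /= bJ [in '[y, x]]dotJ -/a.
rewrite (_ : _ - _ = '[x, x] - `|a| ^+ 2 / b).
  by rewrite subr_ge0 ler_pdivrMr.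
by rewrite normCK; field.
Qed.

Lemma hnormD x y : hnorm (x + y) <= hnorm x + hnorm y.
Proof.
rewrite -(ler_pXn2r (n := 2)) ?nnegrE ?addr_ge0 ?hnorm_ge0 // hnormK.
rewrite dotDl !dotDr sqrrD !hnormK [in '[y, x]]dotJ mulr2n.
rewrite [leLHS](_ : _ = '[x, x] + '[y, y] + ('[x, y] + ('[x, y])^*)); last by ring.
rewrite [leRHS](_ : _ = '[x, x] + '[y, y] +
  (hnorm x * hnorm y + hnorm x * hnorm y)) ?lerD2l; last by ring.
have d0 : '[x, y] + ('[x, y])^* \is Num.real.
  by apply/CrealP; rewrite rmorphD /= conjCK addrC.
apply: le_trans (real_ler_norm d0) _; apply: le_trans (ler_normD _ _) _.
by rewrite norm_conjC lerD ?dot_CS.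
Qed.

Lemma hnorm_tri x y z : hnorm (x - z) <= hnorm (x - y) + hnorm (y - z).
Proof. by apply: le_trans (hnormD _ _); rewrite addrA subrK. Qed.

Lemma hcauchy_cst x : hcauchy (fun=> x).
Proof. by move=> e e0; exists 0%N => m n _ _; rewrite subrr hnorm0. Qed.

Lemma hcauchyD u w : hcauchy u -> hcauchy w -> hcauchy (fun n => u n + w n).
Proof.
move=> hu hw e e0; have e20 : 0 < e / 2%:R by rewrite divr_gt0 // ltr0n.
have [N HN] := hu _ e20; have [M HM] := hw _ e20.
exists (maxn N M) => m n; rewrite !geq_max => /andP[Nm Mm] /andP[Nn Mn].
rewrite opprD addrACA (splitr e) (le_lt_trans (hnormD _ _)) //.
by rewrite ltrD ?HN ?HM.
Qed.

Lemma hcauchyZ c u : hcauchy u -> hcauchy (fun n => c *: u n).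
Proof.
move=> hu e e0; have c0 : 0 < `|c| + 1 by rewrite ltr_wpDl.
have [N HN] := hu _ (divr_gt0 e0 c0); exists N => m n Nm Nn.
rewrite -scalerBr hnormZ; have := HN _ _ Nm Nn; rewrite ltr_pdivlMr // mulrC.
by apply: le_lt_trans; rewrite mulrDl mul1r lerDl hnorm_ge0.
Qed.

Lemma hcauchy_bounded u : hcauchy u ->
  exists2 M : C, 0 < M & exists N, forall n, (N <= n)%N -> hnorm (u n) <= M.
Proof.
move=> /(_ 1 ltr01)[N HN]; exists (1 + hnorm (u N)).
  by rewrite ltr_wpDr ?hnorm_ge0.
exists N => n Nn; rewrite -[u n](subrK (u N)).
by apply: le_trans (hnormD _ _) _; rewrite lerD2r ltW ?HN.
Qed.

Lemma dot_diff x y x' y' : `|'[x, y] - '[x', y']| <=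
  hnorm (x - x') * hnorm y + hnorm x' * hnorm (y - y').
Proof.
rewrite (_ : _ - _ = '[x - x', y] + '[x', y - y']).
  by apply: le_trans (ler_normD _ _) _; rewrite lerD ?dot_CS.
by rewrite dotBl dotBr addrA subrK.
Qed.

Lemma ccauchy_dot u w :
  hcauchy u -> hcauchy w -> ccauchy (fun n => '[u n, w n]).
Proof.
move=> hu hw e e0.
have [M M0 [N1 HM]] := hcauchy_bounded hw.
have [M' M'0 [N2 HM']] := hcauchy_bounded hu.
have e1 : 0 < e / 2%:R / M by rewrite !divr_gt0 // ltr0n.
have e2 : 0 < e / 2%:R / M' by rewrite !divr_gt0 // ltr0n.
have [N3 H3] := hu _ e1; have [N4 H4] := hw _ e2.
exists (maxn (maxn N1 N2) (maxn N3 N4)) => m n.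
rewrite !geq_max => /andP[/andP[m1 m2] /andP[m3 m4]].
move=> /andP[/andP[n1 n2] /andP[n3 n4]].
apply: le_lt_trans (dot_diff _ _ _ _) _.
rewrite (splitr e) ltrD //.
  apply: le_lt_trans (ler_wpM2l (hnorm_ge0 _) (HM _ m1)) _.
  by rewrite -ltr_pdivlMr // H3.
apply: le_lt_trans (ler_wpM2r (hnorm_ge0 _) (HM' _ n2)) _.
by rewrite mulrC -ltr_pdivlMr // H4.
Qed.

End PreHilbertTheory.

Section Completion.
Variables (R : realType) (V : preHilbertType R).
Local Notation C := R[i].
Implicit Types (x y : V) (u w : nat -> V).

(* [repr u f]: the Cauchy sequence [u] represents the conjugate-linear
   functional [f], that is, [f = lim_n '[u n, -]]. *)
Definition repr u (f : V -> C^o) : Prop :=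
  hcauchy u /\ forall x, clim (fun n => '[u n, x]) (f x).

Definition compl_pred : {pred V -> C^o} := [pred f | `[< exists u, repr u f >]].

Lemma repr_lin c u w f g : repr u f -> repr w g ->
  repr (fun n => c *: u n + w n) (c *: f + g).
Proof.
move=> [uc uf] [wc wg]; split; first by apply: hcauchyD => //; apply: hcauchyZ.
move=> x; apply: eq_clim (climD (climZ c (uf x)) (wg x)) => n.
by rewrite dotDl dotZl.
Qed.

Lemma compl_closed : GRing.submod_closed compl_pred.
Proof.
split.
  apply/asboolP; exists (fun=> 0); split; first exact: hcauchy_cst.
  by move=> x; apply: eq_clim (clim_cst 0) => n; rewrite dot0l.
move=> c f g /asboolP[u uf] /asboolP[w wg]; apply/asboolP.
by eexists; apply: repr_lin uf wg.
Qed.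
HB.instance Definition _ :=
  GRing.isSubmodClosed.Build C (V -> C^o) compl_pred compl_closed.

(* The completion of [V], a Cauchy sequence [u] being identified, modulo null
   sequences, with the functional [lim_n '[u n, -]]. See [embed_dot],
   [embed_dense] and [compl_complete]. *)
Record compl := Compl { compl_fun :> V -> C^o ; _ : compl_fun \in compl_pred }.

HB.instance Definition _ := [isSub for compl_fun].
HB.instance Definition _ := [Choice of compl by <:].
HB.instance Definition _ := [SubChoice_isSubLmodule of compl by <:].

End Completion.


Section CompletionDot.
Variables (R : realType) (V : preHilbertType R).
Local Notation C := R[i].
Local Notation K := (compl V).
Implicit Types (x y : V) (u w : nat -> V) (f g h : K).

Lemma compl_ext f g : f =1 g -> f = g.
Proof. by move=> fg; apply/val_inj/funext. Qed.

Lemma complP f : exists u, repr u f.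
Proof. by apply/asboolP; case: f. Qed.

Definition crep f : nat -> V := projT1 (cid (complP f)).

Lemma crepP f : repr (crep f) f.
Proof. exact: projT2 (cid (complP f)). Qed.

Lemma hlim_subproof u : hcauchy u -> exists f : V -> C^o, repr u f.
Proof.
move=> hu; have h x : exists l, clim (fun n => '[u n, x]) l.
  by apply: ccauchy_lim; apply: ccauchy_dot => //; apply: hcauchy_cst.
by exists (fun x => projT1 (cid (h x))); split=> // x; case: cid.
Qed.

(* The class of a Cauchy sequence (0 for a sequence that is not Cauchy). *)
Definition hlim u : K := xget 0 [set f : K | repr u f].

Lemma hlimP u : hcauchy u -> repr u (hlim u).
Proof.
move=> hu; have [f uf] := hlim_subproof hu.
have fP : f \in @compl_pred R V by apply/asboolP; exists u.
by rewrite /hlim; case: xgetP => [g _ //|/(_ (Compl fP))[]].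
Qed.

Lemma repr_inj u f g : repr u f -> repr u g -> f = g.
Proof. by move=> [_ uf] [_ ug]; apply: compl_ext => x; apply: clim_uniq. Qed.

Lemma hlimE u f : repr u f -> hlim u = f.
Proof. by move=> uf; apply: repr_inj (uf); apply: hlimP; case: uf. Qed.

Lemma clim_shift (z : nat -> C) l k :
  clim z l -> clim (fun n => z (n + k)%N) l.
Proof.
move=> h e /h[N HN]; exists N => n Nn; apply: HN.
by rewrite (leq_trans Nn) // leq_addr.
Qed.

Lemma clim_le z (l a M : C) N : clim z l ->
  (forall n, (N <= n)%N -> `|z n - a| <= M) -> `|l - a| <= M.
Proof.
move=> h H; apply: (@clim_le0 _ (fun n => z (n + N)%N - a)).
  exact: climD (clim_shift N h) (clim_cst _).
by move=> n; apply: H; rewrite leq_addl.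
Qed.

Lemma repr_clim u f w l : repr u f -> hcauchy w ->
  clim (fun n => '[u n, w n]) l -> clim (fun n => f (w n)) l.
Proof.
move=> [hu uf] hw hl e e0; have e20 : 0 < e / 2%:R by rewrite divr_gt0 // ltr0n.
have [M M0 [N1 HM]] := hcauchy_bounded hw.
have [N2 H2] := hu _ (divr_gt0 e20 M0); have [N3 H3] := hl _ e20.
exists (maxn N1 (maxn N2 N3)) => n; rewrite !geq_max => /and3P[n1 n2 n3].
rewrite -[f _](subrK '[u n, w n]) -addrA (splitr e).
apply: le_lt_trans (ler_normD _ _) _; rewrite ler_ltD ?H3 //.
apply: (clim_le (N := n) (uf (w n))) => m nm; rewrite -dotBl.
apply: le_trans (dot_CS _ _) _; rewrite -(divfK (lt0r_neq0 M0) (e / 2%:R)).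
by rewrite ler_pM ?hnorm_ge0 ?HM // ltW // H2 // (leq_trans n2).
Qed.

(* The inner product of the classes of [u] and [w] is [lim_n '[u n, w n]]. *)
Definition cdot f g : C :=
  xget 0 [set l : C | clim (fun n => '[crep f n, crep g n]) l].

Lemma cdotE u w f g : repr u f -> repr w g ->
  clim (fun n => '[u n, w n]) (cdot f g).
Proof.
move=> uf wg; have [cf rf] := crepP f; have [cg rg] := crepP g.
have [hu _] := uf; have [hw _] := wg.
have h : clim (fun n => '[crep f n, crep g n]) (cdot f g).
  rewrite /cdot; case: xgetP => [l _ //|no].
  by have [l /no[]] := ccauchy_lim (ccauchy_dot cf cg).
have [l1 h1] := ccauchy_lim (ccauchy_dot hu cg).
have -> : cdot f g = l1.
  apply: clim_uniq (repr_clim uf cg h1).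
  exact: repr_clim (crepP f) cg h.
have [l2 h2] := ccauchy_lim (ccauchy_dot hu hw).
suff -> : l1 = l2 by [].
have J z l : clim z l -> clim (fun n => (z n)^*) l^* := @climJ R z l.
have s1 : clim (fun n => '[crep g n, u n]) l1^*.
  by apply: eq_clim (J _ _ h1) => n; rewrite -dotJ.
have s2 : clim (fun n => '[w n, u n]) l2^*.
  by apply: eq_clim (J _ _ h2) => n; rewrite -dotJ.
apply: (can_inj (@conjCK _)).
apply: clim_uniq (repr_clim (crepP g) hu s1) (repr_clim wg hu s2).
Qed.

Lemma repr_linK c u w f g : repr u f -> repr w g ->
  repr (fun n => c *: u n + w n) (c *: f + g : K).
Proof. by move=> uf wg; have := repr_lin c uf wg. Qed.

Fact cdot_bilinear : bilinear_for
  (GRing.Scale.Law.clone _ _ *%R _) (GRing.Scale.Law.clone _ _ (conjC \; *%R) _) cdot.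
Proof.
split=> [g c f f'|f c g g'].
  apply: clim_uniq (cdotE (repr_linK c (crepP f) (crepP f')) (crepP g)) _.
  apply: eq_clim (climD (climZ c (cdotE (crepP f) (crepP g)))
    (cdotE (crepP f') (crepP g))) => n.
  by rewrite dotDl dotZl.
apply: clim_uniq (cdotE (crepP f) (repr_linK c (crepP g) (crepP g'))) _.
apply: eq_clim (climD (climZ c^* (cdotE (crepP f) (crepP g)))
  (cdotE (crepP f) (crepP g'))) => n.
by rewrite dotDr dotZr.
Qed.
HB.instance Definition _ := bilinear_isBilinear.Build C K K C _ _ cdot
  cdot_bilinear.

Fact cdot_hermitian f g : cdot f g = (-1) ^+ false * (cdot g f)^*.
Proof.
rewrite expr0 mul1r; apply: clim_uniq (cdotE (crepP f) (crepP g)) _.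
by apply: eq_clim (climJ (cdotE (crepP g) (crepP f))) => n; rewrite -dotJ.
Qed.
HB.instance Definition _ :=
  isHermitianSesquilinear.Build C K false conjC cdot cdot_hermitian.

Fact cdot_gt0 f : f != 0 -> 0 < cdot f f.
Proof.
move=> f0; have [hu uf] := crepP f; have h := cdotE (crepP f) (crepP f).
have p : 0 <= cdot f f by apply: clim_ge0 h _ => n; apply: dot_ge0.
rewrite lt_def p andbT; apply: contra f0 => /eqP z; apply/eqP.
apply: compl_ext => x; apply: clim_uniq (uf x) _ => e e0.
have x1 : 0 < hnorm x + 1 by rewrite ltr_wpDl ?hnorm_ge0.
have e1 : 0 < e / (hnorm x + 1) by rewrite divr_gt0.
rewrite z in h; have [N HN] := h _ (exprn_gt0 2 e1); exists N => n /HN.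
rewrite !subr0 ger0_norm ?dot_ge0 // -hnormK ltr_pXn2r ?nnegrE ?hnorm_ge0 //;
  last exact: ltW.
rewrite ltr_pdivlMr // => lt; apply: le_lt_trans (dot_CS _ _) _.
by apply: le_lt_trans lt; rewrite ler_wpM2l ?hnorm_ge0 // lerDl.
Qed.
HB.instance Definition _ := isDotProduct.Build C K cdot cdot_gt0.

HB.instance Definition _ := isPreHilbert.Build R K (cdot : {dot _ for conjC}).

End CompletionDot.

Section CompletionTheory.
Variables (R : realType) (V : preHilbertType R).
Local Notation C := R[i].
Local Notation K := (compl V).
Implicit Types (x y : V) (u w : nat -> V) (f g h : K).

Lemma compl_dotE u w f g : repr u f -> repr w g ->
  clim (fun n => '[u n, w n]) '[f, g].
Proof. exact: cdotE. Qed.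

Definition embed x : K := hlim (fun=> x).

Lemma embedP x : repr (fun=> x) (embed x).
Proof. exact/hlimP/hcauchy_cst. Qed.

Fact embed_linear : linear embed.
Proof. by move=> c x y; apply: hlimE; apply: repr_linK; apply: embedP. Qed.
HB.instance Definition _ := GRing.isLinear.Build C V K _ embed embed_linear.

Lemma embed_dot x y : '[embed x, embed y] = '[x, y].
Proof. exact: clim_uniq (compl_dotE (embedP x) (embedP y)) (clim_cst _). Qed.

Lemma embed_hnorm x : hnorm (embed x) = hnorm x.
Proof. by rewrite /hnorm embed_dot. Qed.

Lemma reprB u w f g : repr u f -> repr w g -> repr (fun n => u n - w n) (f - g).
Proof.
move=> uf wg; rewrite addrC -scaleN1r.
have := repr_linK (-1) wg uf; congr repr.
by apply/funext => n; rewrite scaleN1r addrC.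
Qed.

Lemma repr_dist u f (e : C) : repr u f -> 0 < e ->
  exists N, forall n, (N <= n)%N -> hnorm (f - embed (u n)) < e.
Proof.
move=> uf e0; have [hu _] := uf.
have e2 : 0 < e / 2%:R by rewrite divr_gt0 // ltr0n.
have [N HN] := hu _ e2; exists N => n Nn.
apply: (@le_lt_trans _ _ (e / 2%:R)); last first.
  by rewrite ltr_pdivrMr ?ltr0n // mulr_natr mulr2n ltrDl.
rewrite -(ler_pXn2r (n := 2)) ?nnegrE ?hnorm_ge0 ?(ltW e2) // hnormK.
have r := reprB uf (embedP (u n)).
rewrite -[leLHS]ger0_norm ?dot_ge0 // -[X in `|X|]subr0.
apply: (clim_le (N := N) (compl_dotE r r)) => m Nm.
rewrite subr0 ger0_norm ?dot_ge0 // -hnormK.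
by rewrite ler_pXn2r ?nnegrE ?hnorm_ge0 ?ltW ?HN.
Qed.

Lemma embed_dense f : hclosure (range embed) f.
Proof.
move=> e e0; have [N HN] := repr_dist (crepP f) e0.
by exists (embed (crep f N)); [exists (crep f N) | apply: HN].
Qed.

Lemma compl_complete (F : nat -> K) : hcauchy F ->
  exists f, forall e : C, 0 < e ->
    exists N, forall n, (N <= n)%N -> hnorm (F n - f) < e.
Proof.
move=> hF; have ep n : 0 < n.+1%:R^-1 :> C by rewrite invr_gt0 ltr0n.
have hu n : exists x, hnorm (F n - embed x) < n.+1%:R^-1.
  by have [_ [x _ <-] ?] := embed_dense (F n) (ep n); exists x.
pose u n := projT1 (cid (hu n)).
have uF n : hnorm (F n - embed (u n)) < n.+1%:R^-1 := projT2 (cid (hu n)).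
have small e : 0 < e -> exists N, forall n, (N <= n)%N -> n.+1%:R^-1 < e :> C.
  case: e => a b; rewrite ltcE /= => /andP[/eqP-> a0].
  have [N HN] := ltr_add_invr a0.
  exists N => n Nn; rewrite (_ : n.+1%:R^-1 = (n.+1%:R^-1)%:C%C); last first.
    by rewrite fmorphV rmorph_nat.
  rewrite ltcE /= eqxx /=; apply: le_lt_trans HN; rewrite add0r.
  by rewrite lef_pV2 ?posrE ?ltr0n // ler_nat.
have cu : hcauchy u.
  move=> e e0; have e3 : 0 < e / 3%:R by rewrite divr_gt0 // ltr0n.
  have [N HN] := hF _ e3; have [M HM] := small _ e3.
  exists (maxn N M) => m n; rewrite !geq_max => /andP[Nm Mm] /andP[Nn Mn].
  rewrite -embed_hnorm linearB /=.
  apply: le_lt_trans (hnorm_tri _ (F m) _) _.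
  rewrite (_ : e = e / 3%:R + (e / 3%:R + e / 3%:R)); last by field.
  apply: ltrD; first by rewrite hnormBC; apply: lt_trans (uF m) (HM m Mm).
  apply: le_lt_trans (hnorm_tri _ (F n) _) _.
  by apply: ltrD; [exact: HN | exact: lt_trans (uF n) (HM n Mn)].
exists (hlim u) => e e0; have e2 : 0 < e / 2%:R by rewrite divr_gt0 // ltr0n.
have [N HN] := repr_dist (hlimP cu) e2; have [M HM] := small _ e2.
exists (maxn N M) => n; rewrite geq_max => /andP[Nn Mn].
apply: le_lt_trans (hnorm_tri _ (embed (u n)) _) _.
rewrite (splitr e); apply: ltrD; first exact: lt_trans (uF n) (HM n Mn).
by rewrite hnormBC; apply: HN.
Qed.

End CompletionTheory.

Section GramSchmidt.
Variables (R : realType) (V : preHilbertType R).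

(* Every finite family is contained in the span of a finite orthonormal one. *)
Lemma orthonormal_basis (xs : seq V) : exists es : seq V,
  [/\ uniq es, {in es &, forall e e', '[e, e'] = (e == e')%:R} &
      {in xs, forall x, x = \sum_(e <- es) '[x, e] *: e}].
Proof.
elim: xs => [|x xs [es [ues oes ses]]]; first by exists [::].
pose y := x - \sum_(e <- es) '[x, e] *: e.
have yo : {in es, forall e, '[y, e] = 0}.
  move=> e ein; rewrite dotBl linear_sumlz /= (bigD1_seq e) //= dotZl (oes _ _ ein ein).
  rewrite eqxx mulr1 big1_seq ?addr0 ?subrr // => e' /andP[e'e e'in].
  by rewrite dotZl (oes _ _ e'in ein) (negPf e'e) mulr0.
have [y0|y0] := eqVneq y 0.
  exists es; split=> // z; rewrite inE => /predU1P[->|]; last exact: ses.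
  exact/subr0_eq.
have ny : hnorm y != 0 by rewrite hnorm_eq0.
pose e0 := (hnorm y)^-1 *: y.
have e00 : '[e0, e0] = 1.
  by rewrite -hnormK hnormZ ger0_norm ?invr_ge0 ?hnorm_ge0 // mulVf ?expr1n.
have e0o : {in es, forall e, '[e0, e] = 0}.
  by move=> e /yo h; rewrite dotZl h mulr0.
have e0es : e0 \notin es.
  by apply/negP => /e0o; rewrite e00 => /eqP; rewrite oner_eq0.
have dec z : z = \sum_(e <- es) '[z, e] *: e + '[z, e0] *: e0 ->
    z = \sum_(e <- e0 :: es) '[z, e] *: e by rewrite big_cons addrC.
exists (e0 :: es); split.
- by rewrite /= e0es.
- move=> e e'; rewrite !inE => /predU1P[->|ein] /predU1P[->|e'in].
  + by rewrite e00 eqxx.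
  + by rewrite e0o // eq_sym (negPf (memPn e0es _ e'in)).
  + by rewrite dotJ e0o // rmorph0 (negPf (memPn e0es _ ein)).
  + exact: oes.
- move=> z; rewrite inE => /predU1P[->|zin]; apply: dec.
    rewrite -[LHS](subrK (\sum_(e <- es) '[x, e] *: e)) -/y addrC.
    congr (_ + _); have -> : '[x, e0] = '[y, e0].
      rewrite /y dotBl linear_sumlz /= big1_seq ?subr0 // => e /= ein.
      by rewrite dotZl (dotJ e) e0o // rmorph0 mulr0.
    rewrite dotZr -hnormK scalerA fmorphV /=.
    rewrite (CrealP (ger0_real (hnorm_ge0 y))) [X in X *: _](_ : _ = 1).
      by rewrite scale1r.
    by field.
  have z0 : '[z, e0] = 0.
    rewrite [z]ses // linear_sumlz /= big1_seq // => e /= ein.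
    by rewrite dotZl (dotJ e) e0o // rmorph0 mulr0.
  by rewrite z0 scale0r addr0; apply: ses.
Qed.

End GramSchmidt.

Section Fock.
Variables (R : realType) (H : preHilbertType R).
Local Notation C := R[i].
Implicit Types (x y : H) (u v w : seq H).

(* A family of n-linear maps, one for each [n], as a function on words. *)
Definition multilinear (Z : lmodType C) (g : seq H -> Z) : Prop :=
  forall u v (c : C) x y,
    g (u ++ (c *: x + y) :: v) = c *: g (u ++ x :: v) + g (u ++ y :: v).

Record mform := Mform { mform_fun :> seq H -> C^o ;
                        mformP : multilinear mform_fun }.

Definition fock_pred : {pred mform -> C^o} := [pred phi : mform -> C^o |
  `[< exists s : seq (C * seq H),
        phi = \sum_(p <- s) p.1 *: (fun f : mform => f p.2) >]].

Lemma fock_closed : GRing.submod_closed fock_pred.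
Proof.
split; first by apply/asboolP; exists [::]; rewrite big_nil.
move=> c f g /asboolP[s ->] /asboolP[t ->]; apply/asboolP.
exists ([seq (c * p.1, p.2) | p <- s] ++ t); rewrite big_cat big_map /=.
by congr (_ + _); rewrite scaler_sumr; apply: eq_bigr => p _; rewrite scalerA.
Qed.
HB.instance Definition _ :=
  GRing.isSubmodClosed.Build C (mform -> C^o) fock_pred fock_closed.

(* The algebraic direct sum of all H^(x)n, as the span of the elementary tensors
   in the space of functionals on multilinear forms. Its universal property is
   [tens_multi], [lift_linear] and [lift_tens]. *)
Record fock := Fock { fock_fun :> mform -> C^o ; _ : fock_fun \in fock_pred }.

HB.instance Definition _ := [isSub for fock_fun].
HB.instance Definition _ := [Choice of fock by <:].
HB.instance Definition _ := [SubChoice_isSubLmodule of fock by <:].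

Fact tens_subproof w : (fun f : mform => f w) \in fock_pred.
Proof. by apply/asboolP; exists [:: (1, w)]; rewrite big_seq1 scale1r. Qed.

(* [tens [:: x_n; ...; x_1]] is x_n (x) ... (x) x_1; [tens [::]] is the vacuum. *)
Definition tens w : fock := Fock (tens_subproof w).

Lemma fock_ext (phi psi : fock) : fock_fun phi =1 fock_fun psi -> phi = psi.
Proof. by move=> h; apply/val_inj/funext. Qed.

Lemma fock_sumE I (r : seq I) (F : I -> fock) (f : mform) :
  (\sum_(i <- r) F i) f = \sum_(i <- r) F i f.
Proof.
elim: r => [|i r IH]; first by rewrite !big_nil.
by rewrite !big_cons -IH.
Qed.

Lemma fockP (phi : fock) :
  exists s : seq (C * seq H), phi = \sum_(p <- s) p.1 *: tens p.2.
Proof.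
case: phi => phi h; have /asboolP[s E] := h; exists s; apply: fock_ext => f /=.
rewrite fock_sumE E; elim: {E} s => [|p s IH]; first by rewrite !big_nil.
by rewrite !big_cons -IH.
Qed.

Definition frep phi := projT1 (cid (fockP phi)).

Lemma frepP phi : phi = \sum_(p <- frep phi) p.1 *: tens p.2.
Proof. exact: projT2 (cid (fockP phi)). Qed.

Fixpoint kdot u v : C :=
  match u, v with
  | [::], [::] => 1
  | x :: u', y :: v' => '[x, y] * kdot u' v'
  | _, _ => 0
  end.

Lemma kdot_size u v : size u != size v -> kdot u v = 0.
Proof.
by elim: u v => [|x u IH] [|y v] //= h; rewrite IH ?mulr0.
Qed.

Lemma kdotJ u v : kdot u v = (kdot v u)^*.
Proof.
elim: u v => [|x u IH] [|y v] /=; rewrite ?rmorph0 ?rmorph1 //.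
by rewrite rmorphM /= -dotJ -IH.
Qed.

Lemma kdot_multi v : multilinear (Z := C^o) (kdot^~ v).
Proof.
move=> u w c x y; elim: u v => [|z u IH] [|t v] /=; rewrite ?scaler0 ?addr0 //.
  by rewrite dotDl dotZl mulrDl -mulrA.
by rewrite IH mulrDr /GRing.scale /= mulrCA.
Qed.

Definition kform v : mform := Mform (kdot_multi v).

Lemma multi_cons (Z : lmodType C) (g : seq H -> Z) x :
  multilinear g -> multilinear (fun w => g (x :: w)).
Proof. by move=> h u v c y z; apply: (h (x :: u)). Qed.

Lemma multi_linear (Z : lmodType C) (g : seq H -> Z) w :
  multilinear g -> linear (fun x => g (x :: w)).
Proof. by move=> h c x y; apply: (h [::]). Qed.

Fixpoint ewords (es : seq H) n : seq (seq H) :=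
  if n is n'.+1 then [seq e :: v | e <- es, v <- ewords es n'] else [:: [::]].

Lemma ewords_expand (es : seq H) (Z : lmodType C) (g : seq H -> Z) w :
  {in w, forall x, x = \sum_(e <- es) '[x, e] *: e} -> multilinear g ->
  g w = \sum_(v <- ewords es (size w)) kdot w v *: g v.
Proof.
elim: w g => [|x w IH] g h mg; first by rewrite big_seq1 scale1r.
rewrite /= big_allpairs_dep /=.
transitivity (\sum_(e <- es) '[x, e] *: g (e :: w)).
  rewrite [in LHS](h x) ?mem_head //.
  pose L := GRing.isLinear.Build _ _ _ _ (fun z => g (z :: w)) (multi_linear w mg).
  pose G : {linear H -> Z} := HB.pack (fun z => g (z :: w)) L.
  rewrite -[LHS]/(G _) linear_sum; apply: eq_bigr => e _.
  by rewrite linearZ.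
apply: eq_bigr => e _; rewrite (IH (fun w => g (e :: w))).
- by rewrite scaler_sumr; apply: eq_bigr => v _; rewrite scalerA.
- by move=> z zw; apply: h; rewrite inE zw orbT.
- exact: multi_cons.
Qed.

Lemma size_ewords es n v : v \in ewords es n -> size v = n.
Proof.
elim: n v => [|n IH] v /=; first by rewrite inE => /eqP->.
by case/allpairsP => -[e t] /= [_ /IH h ->]; rewrite /= h.
Qed.

Lemma words_expand (s : seq (C * seq H)) : exists E : seq (seq H),
  forall (Z : lmodType C) (g : seq H -> Z), multilinear g ->
  {in s, forall p, g p.2 = \sum_(v <- E) kdot p.2 v *: g v}.
Proof.
have [es [_ _ hes]] := orthonormal_basis (flatten [seq p.2 | p <- s]).
pose N := \max_(p <- s) size p.2.
exists (flatten [seq ewords es n | n <- iota 0 N.+1]) => Z g mg p ps.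
rewrite big_flatten big_map (bigD1_seq (size p.2)) ?iota_uniq //; last first.
  by rewrite mem_iota add0n ltnS /N; apply: (leq_bigmax_seq (F := fun p : C * seq H => size p.2)).
rewrite -ewords_expand //; last first.
  move=> x xp; apply: hes; apply/flattenP; exists p.2 => //.
  by apply/mapP; exists p.
rewrite big1_seq => [|n /andP[np _]]; first by rewrite /= addr0.
rewrite big1_seq // => v /= /size_ewords sv.
by rewrite kdot_size ?scale0r // sv eq_sym.
Qed.

Lemma tens_indep (s : seq (C * seq H)) (Z : lmodType C) (g : seq H -> Z) :
  multilinear g -> \sum_(p <- s) p.1 *: tens p.2 = 0 ->
  \sum_(p <- s) p.1 *: g p.2 = 0.
Proof.
move=> mg s0; have [E hE] := words_expand s.
transitivity (\sum_(p <- s) \sum_(v <- E) (p.1 * kdot p.2 v) *: g v).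
  apply: eq_big_seq => p ps; rewrite (hE _ _ mg p ps) scaler_sumr.
  by apply: eq_bigr => v _; rewrite scalerA.
rewrite exchange_big big1 // => v _ /=; rewrite -scaler_suml.
have := congr1 (fun phi : fock => phi (kform v)) s0.
by rewrite fock_sumE /= => ->; rewrite scale0r.
Qed.

(* For multilinear [g], the linear map with [tens w] |-> [g w]; independent of
   the chosen decomposition [frep phi] by [tens_indep]. *)
Definition lift (Z : lmodType C) (g : seq H -> Z) (phi : fock) : Z :=
  \sum_(p <- frep phi) p.1 *: g p.2.

Lemma liftE (Z : lmodType C) (g : seq H -> Z) (s : seq (C * seq H)) :
  multilinear g ->
  lift g (\sum_(p <- s) p.1 *: tens p.2) = \sum_(p <- s) p.1 *: g p.2.
Proof.
move=> mg; apply/subr0_eq; set phi := (\sum_(p <- s) _).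
have neg (W : lmodType C) (k : seq H -> W) :
  \sum_(p <- frep phi ++ [seq (- q.1, q.2) | q <- s]) p.1 *: k p.2 =
  \sum_(p <- frep phi) p.1 *: k p.2 - \sum_(p <- s) p.1 *: k p.2.
  rewrite big_cat big_map -sumrN; congr (_ + _).
  by apply: eq_bigr => q _; rewrite scaleNr.
by rewrite /lift -neg; apply: tens_indep => //; rewrite neg -frepP subrr.
Qed.

Lemma lift_linear (Z : lmodType C) (g : seq H -> Z) :
  multilinear g -> linear (lift g).
Proof.
move=> mg c phi psi.
rewrite [phi in LHS]frepP [psi in LHS]frepP scaler_sumr.
rewrite (_ : _ + _ = \sum_(p <- [seq (c * p.1, p.2) | p <- frep phi] ++ frep psi)
  p.1 *: tens p.2); last first.
  rewrite big_cat big_map; congr (_ + _).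
  by apply: eq_bigr => p _; rewrite scalerA.
rewrite liftE // big_cat big_map /lift scaler_sumr; congr (_ + _).
by apply: eq_bigr => p _; rewrite scalerA.
Qed.

Lemma lift_tens (Z : lmodType C) (g : seq H -> Z) w :
  multilinear g -> lift g (tens w) = g w.
Proof.
move=> mg; have := liftE [:: (1, w)] mg; by rewrite !big_seq1 !scale1r.
Qed.

(* The inner product with [<x_n...x_1, y_n...y_1> = \prod_i <x_i, y_i>], tensors
   of different degrees being orthogonal. *)
Definition fdot (phi psi : fock) : C :=
  \sum_(p <- frep phi) \sum_(q <- frep psi) p.1 * (q.1)^* * kdot p.2 q.2.

Lemma fdotEl phi psi : fdot phi psi = lift (Z := C^o)
  (fun u => \sum_(q <- frep psi) (q.1)^* * kdot u q.2) phi.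
Proof.
apply: eq_bigr => p _; rewrite /GRing.scale /= mulr_sumr.
by apply: eq_bigr => q _; rewrite mulrA.
Qed.

Let fdotl_multi psi : multilinear (Z := C^o)
  (fun u => \sum_(q <- frep psi) (q.1)^* * kdot u q.2).
Proof.
move=> u v c x y; rewrite scaler_sumr -big_split; apply: eq_bigr => q _ /=.
by rewrite kdot_multi mulrDr /GRing.scale /= mulrCA.
Qed.

Lemma fdotJ phi psi : fdot phi psi = (fdot psi phi)^*.
Proof.
rewrite /fdot rmorph_sum exchange_big; apply: eq_bigr => q _.
rewrite rmorph_sum; apply: eq_bigr => p _.
by rewrite !rmorphM /= conjCK -kdotJ [p.1 * _]mulrC.
Qed.

Fact fdot_bilinear : bilinear_for
  (GRing.Scale.Law.clone _ _ *%R _) (GRing.Scale.Law.clone _ _ (conjC \; *%R) _) fdot.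
Proof.
have l psi : linear_for *%R (fdot^~ psi).
  by move=> c phi phi'; rewrite !fdotEl lift_linear.
split=> [psi|phi c psi psi']; first exact: l.
by rewrite fdotJ l rmorphD rmorphM /= -!fdotJ.
Qed.
HB.instance Definition _ := bilinear_isBilinear.Build C fock fock C _ _ fdot
  fdot_bilinear.

Fact fdot_hermitian phi psi : fdot phi psi = (-1) ^+ false * (fdot psi phi)^*.
Proof. by rewrite expr0 mul1r -fdotJ. Qed.
HB.instance Definition _ :=
  isHermitianSesquilinear.Build C fock false conjC fdot fdot_hermitian.

Fact fdot_gt0 phi : phi != 0 -> 0 < fdot phi phi.
Proof.
move=> phi0; have [E hE] := words_expand (frep phi).
have d : fdot phi phi = \sum_(v <- E) `|phi (kform v)| ^+ 2.
  have pE v : phi (kform v) = \sum_(p <- frep phi) p.1 * kdot p.2 v.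
    by rewrite {1}[phi]frepP fock_sumE.
  transitivity (\sum_(v <- E) \sum_(p <- frep phi) \sum_(q <- frep phi)
      (p.1 * kdot p.2 v) * (q.1 * kdot q.2 v)^*).
    rewrite exchange_big; apply: eq_big_seq => p ps /=.
    rewrite exchange_big; apply: eq_big_seq => q qs /=.
    rewrite (hE _ _ (kdot_multi q.2) p ps) mulr_sumr; apply: eq_bigr => v _.
    by rewrite [kdot v q.2]kdotJ rmorphM /GRing.scale /=; ring.
  apply: eq_bigr => v _; rewrite normCK pE rmorph_sum mulr_suml.
  by apply: eq_bigr => p _; rewrite mulr_sumr.
have p0 : 0 <= fdot phi phi.
  by rewrite d sumr_ge0 // => v _; rewrite exprn_ge0.
rewrite lt_def p0 andbT; apply: contra phi0; rewrite d psumr_eq0; last first.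
  by move=> v _; rewrite exprn_ge0.
move=> /allP z; apply/eqP; apply: fock_ext => f.
rewrite {1}[phi]frepP fock_sumE.
transitivity (\sum_(p <- frep phi) \sum_(v <- E) p.1 * (kdot p.2 v * f v)).
  apply: eq_big_seq => p ps; rewrite -mulr_sumr.
  by congr (_ * _); apply: (hE _ _ (@mformP f) p ps).
rewrite exchange_big big1_seq // => v /= vE.
have /eqP : phi (kform v) == 0 by have := z v vE; rewrite /= expf_eq0 normr_eq0.
rewrite [phi in LHS]frepP fock_sumE => h.
by under eq_bigr do rewrite mulrA; rewrite -mulr_suml [X in X * _]h mul0r.
Qed.
HB.instance Definition _ := isDotProduct.Build C fock fdot fdot_gt0.

HB.instance Definition _ := isPreHilbert.Build R fock (fdot : {dot _ for conjC}).

End Fock.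

Section Subspaces.
Variable R : realType.
Local Notation C := R[i].
Implicit Types V W : preHilbertType R.

Definition hspan V (S : set V) : set V :=
  [set v | exists2 s : seq (C * V),
     forall p, p \in s -> S p.2 & v = \sum_(p <- s) p.1 *: p.2].

Definition hortho V (S : set V) : set V :=
  [set v | forall y, S y -> '[v, y] = 0].

(* [Lin A B] is the space of linear maps between the subspaces [A] and [B]; its
   elements are total functions of which only the restriction to [A] matters. *)
Definition Lin V W (A : set V) (B : set W) : set (V -> W) :=
  [set f | (forall (c : C) x y, A x -> A y -> f (c *: x + y) = c *: f x + f y)
         /\ (forall x, A x -> B (f x))].

Definition is_adjoint V W (A : set V) (B : set W) (f : V -> W) (g : W -> V) :=
  [/\ Lin A B f, Lin B A g & forall x y, A x -> B y -> '[f x, y] = '[x, g y]].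

Lemma hspan_sub V (S : set V) : S `<=` hspan S.
Proof.
move=> v Sv; exists [:: (1, v)]; last by rewrite big_seq1 scale1r.
by move=> p; rewrite inE => /eqP->.
Qed.

Lemma hspan_lin V (S : set V) (c : C) x y :
  hspan S x -> hspan S y -> hspan S (c *: x + y).
Proof.
move=> [s hs ->] [t ht ->]; exists ([seq (c * p.1, p.2) | p <- s] ++ t).
  by move=> p; rewrite mem_cat => /orP[/mapP[q qs ->]|]; [exact: (hs q qs)|exact: ht].
rewrite big_cat big_map scaler_sumr; congr (_ + _).
by apply: eq_bigr => p _; rewrite scalerA.
Qed.

Lemma hspan0 V (S : set V) : hspan S 0.
Proof. by exists [::]; rewrite ?big_nil. Qed.

End Subspaces.

Section FockSpaces.
Variables (R : realType) (H : preHilbertType R).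
Local Notation C := R[i].
Implicit Types (x y : H) (u v w : seq H) (phi psi : fock H).

Definition vac : fock H := tens [::].

Lemma tens_multi : multilinear (@tens R H).
Proof. by move=> u v c x y; apply: fock_ext => f; apply: (@mformP _ _ f). Qed.

(* [crF x phi] is x (x) phi. *)
Definition crF x : fock H -> fock H := lift (fun w => tens (x :: w)).

(* The subspace H^(x)n. *)
Definition grade n : set (fock H) :=
  hspan [set tens w | w in [set w | size w = n]].

Lemma crF_multi x : multilinear (fun w => tens (x :: w)).
Proof. exact: multi_cons tens_multi. Qed.

Lemma crF_tens x w : crF x (tens w) = tens (x :: w).
Proof. exact: lift_tens (crF_multi x). Qed.

Fact crF_bilinear : bilinear_for
  (GRing.Scale.Law.clone _ _ *:%R _) (GRing.Scale.Law.clone _ _ *:%R _) crF.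
Proof.
split=> [phi c x y|x]; last exact: lift_linear (crF_multi x).
change (crF (c *: x + y) phi = c *: crF x phi + crF y phi).
rewrite /crF /lift scaler_sumr -big_split; apply: eq_bigr => p _ /=.
by rewrite (tens_multi [::]) scalerDr !scalerA mulrC.
Qed.
HB.instance Definition _ := bilinear_isBilinear.Build C H (fock H) (fock H) _ _
  crF crF_bilinear.

Lemma crFZ x (c : C) phi : crF x (c *: phi) = c *: crF x phi.
Proof. exact: linearZr_LR. Qed.

Lemma crF_sum x I (r : seq I) (F : I -> fock H) :
  crF x (\sum_(i <- r) F i) = \sum_(i <- r) crF x (F i).
Proof. exact: linear_sumr. Qed.

Lemma tens_dot u v : '[tens u, tens v] = kdot u v.
Proof.
have e (c : C) w : c *: tens w = \sum_(p <- [:: (c, w)]) p.1 *: tens p.2.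
  by rewrite big_seq1.
have l w psi : '[psi, tens w] = lift (Z := C^o) (fun u => kdot u w) psi.
  change (fdot psi (tens w) = lift (Z := C^o) (fun u => kdot u w) psi).
  rewrite fdotJ fdotEl -[tens w]scale1r e liftE; last first.
    move=> a b c x y; rewrite scaler_sumr -big_split; apply: eq_bigr => q _ /=.
    by rewrite kdot_multi mulrDr /GRing.scale /= mulrCA.
  rewrite big_seq1 scale1r rmorph_sum; apply: eq_bigr => p _.
  by rewrite rmorphM /= conjCK -kdotJ.
by rewrite l lift_tens //; apply: kdot_multi.
Qed.

Lemma crF_dot x y phi psi : '[crF x phi, crF y psi] = '[x, y] * '[phi, psi].
Proof.
rewrite [phi]frepP [psi]frepP !crF_sum !dot_suml mulr_sumr.
apply: eq_bigr => p _; rewrite !dot_sumr mulr_sumr; apply: eq_bigr => q _ /=.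
by rewrite !crFZ !dotZl !dotZr !crF_tens !tens_dot /=; ring.
Qed.

Lemma crF_hnorm x phi : hnorm (crF x phi) = hnorm x * hnorm phi.
Proof. by rewrite /hnorm crF_dot rootCMl ?dot_ge0. Qed.

Lemma crF_hcauchy x (u : nat -> fock H) : hcauchy u -> hcauchy (fun n => crF x (u n)).
Proof.
move=> hu e e0; have x1 : 0 < hnorm x + 1 by rewrite ltr_wpDl ?hnorm_ge0.
have [N HN] := hu _ (divr_gt0 e0 x1); exists N => m n Nm Nn.
have := HN m n Nm Nn; rewrite -linearBr crF_hnorm ltr_pdivlMr // mulrC.
by apply: le_lt_trans; rewrite mulrDl mul1r lerDl hnorm_ge0.
Qed.

(* The completed full Fock space, with the continuous extension [crK x] of the
   creation operator [crF x]. *)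
Definition fullfock := compl (fock H).

Definition vacK : fullfock := embed vac.

Definition crK x (f : fullfock) : fullfock := hlim (fun n => crF x (crep f n)).

(* The closure of H^(x)n in the completion. *)
Definition gradeK n : set fullfock := hclosure [set embed phi | phi in grade n].

End FockSpaces.

Section Creation.
Variables (R : realType) (H : preHilbertType R).
Local Notation C := R[i].
Implicit Types (x y : H) (f g : fullfock H).

Lemma crK_repr x u f : repr u f -> repr (fun n => crF x (u n)) (crK x f).
Proof.
move=> uf; have [hu _] := uf; have [hc _] := crepP f.
have hK : repr (fun n => crF x (crep f n)) (crK x f).
  exact/hlimP/crF_hcauchy.
suff -> : crK x f = hlim (fun n => crF x (u n)) by exact/hlimP/crF_hcauchy.
have r2 := hlimP (crF_hcauchy x hu).
apply/eqP; rewrite -subr_eq0 -(dnorm_eq0 dotp); apply/eqP.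
have r := reprB hK r2.
apply: clim_uniq (compl_dotE r r) _.
have d := compl_dotE (reprB (crepP f) uf) (reprB (crepP f) uf).
rewrite subrr dot0l in d.
have := climZ '[x, x] d; rewrite mulr0; apply: eq_clim => n.
by rewrite -linearBr crF_dot.
Qed.

Fact crK_bilinear : bilinear_for
  (GRing.Scale.Law.clone _ _ *:%R _) (GRing.Scale.Law.clone _ _ *:%R _) (@crK R H).
Proof.
split=> [f c x y|x c f g].
  apply: hlimE; change (repr (fun n => crF (c *: x + y) (crep f n))
    (c *: crK x f + crK y f : fullfock H)).
  have := repr_linK c (crK_repr x (crepP f)) (crK_repr y (crepP f)).
  congr repr; apply/funext => n; symmetry.
  by rewrite linearDl linearZl_LR.
change (crK x (c *: f + g) = c *: crK x f + crK x g).
apply: repr_inj (crK_repr x (repr_linK c (crepP f) (crepP g))) _.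
have := repr_linK c (crK_repr x (crepP f)) (crK_repr x (crepP g)).
congr repr; apply/funext => n; symmetry.
by rewrite linearDr linearZr_LR.
Qed.
HB.instance Definition _ := bilinear_isBilinear.Build C H (fullfock H)
  (fullfock H) _ _ (@crK R H) crK_bilinear.

Lemma crK_embed x phi : crK x (embed phi) = embed (crF x phi).
Proof. by apply: repr_inj (crK_repr x (embedP phi)) (embedP _). Qed.

Lemma crK_dot x y f g : '[crK x f, crK y g] = '[x, y] * '[f, g].
Proof.
apply: clim_uniq (compl_dotE (crK_repr x (crepP f)) (crK_repr y (crepP g))) _.
apply: eq_clim (climZ '[x, y] (compl_dotE (crepP f) (crepP g))) => n.
by rewrite crF_dot.
Qed.

Lemma crK_vac x f : '[vacK H, crK x f] = 0.
Proof.
apply: clim_uniq (compl_dotE (embedP _) (crK_repr x (crepP f))) _.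
apply: eq_clim (clim_cst 0) => n; rewrite [crep f n]frepP crF_sum dot_sumr.
rewrite big1 // => p _; rewrite crFZ dotZr crF_tens.
by rewrite (tens_dot [::]) mulr0.
Qed.

Lemma vacK_unit : '[vacK H, vacK H] = 1.
Proof. by rewrite embed_dot tens_dot. Qed.

End Creation.

Section TensorMaps.
Variables (R : realType) (H V : preHilbertType R).
Local Notation C := R[i].
Local Notation K := (fullfock H).
Variables (cr : H -> V -> V) (om : V).

(* [tensS cr S] is H (x) S, with elementary tensors x (x) Y given by [cr x Y];
   [tensS1 cr om S] is (H (x) S) (+) C om. *)
Definition tensS (S : set V) : set V :=
  hspan [set cr x Y | x in [set: H] & Y in S].

Definition tensS1 (S : set V) : set V :=
  [set Z + c *: om | Z in tensS S & c in [set: C]].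

(* id_H (x) f on H (x) S, for [f] linear on the subspace [S]; by [idtE] it does
   not depend on the chosen decomposition of [Z]. *)
Definition idt (S : set V) (f : V -> K) (Z : V) : K :=
  \sum_(p <- xget [::] [set s : seq (H * V) |
      (forall p, p \in s -> S p.2) /\ Z = \sum_(p <- s) cr p.1 p.2])
    crK p.1 (f p.2).

(* (id_H (x) f) (+) id_C on (H (x) S) (+) C om, mapping om to the vacuum. *)
Definition idt1 (S : set V) (f : V -> K) (Z : V) : K :=
  let d := xget (0, 0) [set d : V * C | tensS S d.1 /\ Z = d.1 + d.2 *: om] in
  idt S f d.1 + d.2 *: vacK H.

End TensorMaps.

Section TensorMapsTheory.
Variables (R : realType) (H V : preHilbertType R).
Local Notation C := R[i].
Local Notation K := (fullfock H).
Variables (cr : {bilinear H -> V -> V}) (om : V).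
Hypothesis cr_dot : forall x y X Y, '[cr x X, cr y Y] = '[x, y] * '[X, Y].
Hypothesis cr_om : forall x Y, '[om, cr x Y] = 0.
Hypothesis om_unit : '[om, om] = 1.
Variables (S : set V) (f : V -> K).
Hypothesis S0 : S 0.
Hypothesis S_lin : forall (c : C) x y, S x -> S y -> S (c *: x + y).
Hypothesis f_lin :
  forall (c : C) x y, S x -> S y -> f (c *: x + y) = c *: f x + f y.

Let f0 : f 0 = 0.
Proof. by have := f_lin (-1) S0 S0; rewrite !scaleN1r !addNr. Qed.

Let sum_lin I (r : seq I) (c : I -> C) (Y : I -> V) :
  (forall i, S (Y i)) -> S (\sum_(i <- r) c i *: Y i) /\
  f (\sum_(i <- r) c i *: Y i) = \sum_(i <- r) c i *: f (Y i).
Proof.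
move=> hY; elim: r => [|i r [IH1 IH2]]; first by rewrite !big_nil.
by rewrite !big_cons; split; [apply: S_lin|rewrite f_lin ?IH2].
Qed.

Let indep (s : seq (H * V)) : (forall p, p \in s -> S p.2) ->
  \sum_(p <- s) cr p.1 p.2 = 0 -> \sum_(p <- s) crK p.1 (f p.2) = 0.
Proof.
move=> hs s0; have [es [ues oes hes]] := orthonormal_basis [seq p.1 | p <- s].
pose Y (p : H * V) := if p \in s then p.2 else 0.
have hY p : S (Y p) by rewrite /Y; case: ifP => [/hs|].
have exK p : p \in s -> crK p.1 (f p.2) = \sum_(e <- es) '[p.1, e] *: crK e (f (Y p)).
  move=> ps; rewrite {1}(hes p.1); last by apply/mapP; exists p.
  rewrite /Y ps linear_sumlz; apply: eq_bigr => e _.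
  by rewrite linearZl_LR.
have exV p : p \in s -> cr p.1 p.2 = \sum_(e <- es) '[p.1, e] *: cr e (Y p).
  move=> ps; rewrite {1}(hes p.1); last by apply/mapP; exists p.
  rewrite /Y ps linear_sumlz; apply: eq_bigr => e _.
  by rewrite linearZl_LR.
rewrite (eq_big_seq _ exK) exchange_big big1_seq // => e /= ein.
transitivity (crK e (\sum_(p <- s) '[p.1, e] *: f (Y p))).
  rewrite linear_sumr; apply: eq_bigr => p _; by rewrite linearZr_LR.
rewrite -(sum_lin s (fun p => '[p.1, e]) hY).2.
set T := \sum_(p <- s) _; suff -> : T = 0 by rewrite f0 linear0r.
apply/eqP; rewrite -(dnorm_eq0 dotp); apply/eqP.
have : '[\sum_(p <- s) cr p.1 p.2, cr e T] = 0 by rewrite s0 dot0l.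
rewrite (eq_big_seq _ exV) exchange_big dot_suml (bigD1_seq e) //=.
have crT e' : \sum_(p <- s) '[p.1, e'] *: cr e' (Y p) =
    cr e' (\sum_(p <- s) '[p.1, e'] *: Y p).
  by rewrite linear_sumr; apply: eq_bigr => p _; rewrite linearZr_LR.
rewrite crT cr_dot (oes _ _ ein ein) eqxx mul1r.
rewrite [X in _ + X = _]big1_seq => [|e' /andP[ne e'in]].
  by rewrite addr0.
by rewrite crT cr_dot (oes _ _ e'in ein) (negPf ne) mul0r.
Qed.

Let xget_rep (Z : V) (s : seq (H * V)) :
  (forall p, p \in s -> S p.2) -> Z = \sum_(p <- s) cr p.1 p.2 ->
  idt cr S f Z = \sum_(p <- s) crK p.1 (f p.2).
Proof.
move=> hs Zs; rewrite /idt; case: xgetP => [t _ [ht Zt]|/(_ s)[]//].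
apply/subr0_eq.
have fN p : p \in s -> f (- p.2) = - f p.2.
  by move=> /hs Sp; have := f_lin (-1) Sp S0; rewrite addr0 f0 addr0 !scaleN1r.
have e1 : \sum_(p <- s) cr p.1 (- p.2) = - \sum_(p <- s) cr p.1 p.2.
  by rewrite -sumrN; apply: eq_bigr => p _; rewrite linearNr.
have e2 : \sum_(p <- s) crK p.1 (f (- p.2)) = - \sum_(p <- s) crK p.1 (f p.2).
  by rewrite -sumrN; apply: eq_big_seq => p ps /=; rewrite fN // linearNr.
have := @indep (t ++ [seq (p.1, - p.2) | p <- s]).
rewrite !big_cat !big_map /= -Zt e1 e2 -Zs subrr.
apply=> // p; rewrite mem_cat => /orP[/ht //|/mapP[q qs ->]] /=.
by have := S_lin (-1) (hs q qs) S0; rewrite addr0 scaleN1r.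
Qed.

Lemma idtE (s : seq (H * V)) : (forall p, p \in s -> S p.2) ->
  idt cr S f (\sum_(p <- s) cr p.1 p.2) = \sum_(p <- s) crK p.1 (f p.2).
Proof. by move=> hs; apply: xget_rep. Qed.

Lemma tensSP Z : tensS cr S Z ->
  exists2 s : seq (H * V), forall p, p \in s -> S p.2 &
    Z = \sum_(p <- s) cr p.1 p.2.
Proof.
case=> t ht ->{Z}; elim: t ht => [|[c Z] t IH] ht.
  by exists [::]; rewrite ?big_nil.
have [|s hs E] := IH; first by move=> p pt; apply: ht; rewrite inE pt orbT.
have [x _ [Y SY xY]] : [set cr x Y | x in [set: H] & Y in S] Z.
  by have := ht (c, Z); apply; rewrite mem_head.
exists ((c *: x, Y) :: s).
  by move=> p; rewrite inE => /predU1P[->|/hs].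
by rewrite !big_cons /= linearZl_LR E xY.
Qed.

Lemma idt_cr x Y : S Y -> idt cr S f (cr x Y) = crK x (f Y).
Proof.
move=> SY; have := @idtE [:: (x, Y)]; rewrite !big_seq1; apply=> p.
by rewrite inE => /eqP->.
Qed.

Lemma idt_lin (c : C) Z Z' : tensS cr S Z -> tensS cr S Z' ->
  idt cr S f (c *: Z + Z') = c *: idt cr S f Z + idt cr S f Z'.
Proof.
move=> /tensSP[s hs ->] /tensSP[t ht ->].
rewrite !idtE // scaler_sumr.
have e1 : \sum_(p <- s) cr (c *: p.1) p.2 = \sum_(p <- s) c *: cr p.1 p.2.
  by apply: eq_bigr => p _; rewrite linearZl_LR.
have := @idtE ([seq (c *: p.1, p.2) | p <- s] ++ t).
rewrite !big_cat !big_map /= e1 => ->; last first.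
  by move=> p; rewrite mem_cat => /orP[/mapP[q qs ->]|];
    [exact: (hs q qs)|exact: ht].
rewrite scaler_sumr; congr (_ + _); apply: eq_bigr => p _.
by rewrite linearZl_LR.
Qed.

Lemma idt1E Z (c : C) : tensS cr S Z ->
  idt1 cr om S f (Z + c *: om) = idt cr S f Z + c *: vacK H.
Proof.
have orth Z' : tensS cr S Z' -> '[Z', om] = 0.
  move=> /tensSP[s _ ->]; rewrite dot_suml big1 // => p _.
  by rewrite dotJ cr_om rmorph0.
move=> SZ; rewrite /idt1; case: xgetP => [[Z' c'] _ /= [SZ' E]|]; last first.
  by move=> /(_ (Z, c)) [].
have cc : c = c'.
  have := congr1 (fun v => '[v, om]) E.
  by rewrite !dotDl !dotZl (orth _ SZ) (orth _ SZ') om_unit !mulr1 !add0r.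
by move: E; rewrite cc => /addIr <-.
Qed.

End TensorMapsTheory.

Section InteractingFock.
Variables (R : realType) (H : preHilbertType R).
Local Notation C := R[i].
Local Notation K := (fullfock H).

(* The algebraic direct sum of the pre-Hilbert spaces H_n is [ispace], with H_n
   as its subset [ideg n], a subspace by [ideg0] and [icr_span]; [icr x] is
   a^*(x). *)
Record interacting_fock := InteractingFock {
  ispace :> preHilbertType R ;
  ivac : ispace ;
  ideg : nat -> set ispace ;
  icr : {bilinear H -> ispace -> ispace} ;
  ivac_unit : '[ivac, ivac] = 1 ;
  ideg0 : ideg 0 = [set c *: ivac | c in [set: C]] ;
  ideg_ortho : forall m n X Y, m <> n -> ideg m X -> ideg n Y -> '[X, Y] = 0 ;
  ideg_sum : forall X, exists N (Y : nat -> ispace),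
    (forall n, ideg n (Y n)) /\ X = \sum_(n < N) Y n ;
  icr_span : forall n,
    ideg n.+1 = hspan [set icr x X | x in [set: H] & X in ideg n]
}.

Variable I : interacting_fock.

(* Lambda: x_n (x) ... (x) x_1 |-> a^*(x_n) ... a^*(x_1) Omega. *)
Definition Lam : fock H -> I := lift (foldr (icr I) (ivac I)).

Lemma Lam_multi : multilinear (foldr (icr I) (ivac I)).
Proof.
move=> u v c x y; rewrite !foldr_cat /=.
elim: u => [|z u IH] /=; first by rewrite linearDl linearZl_LR.
by rewrite IH linearDr linearZr_LR.
Qed.

Lemma Lam_vac : Lam (vac H) = ivac I.
Proof. by rewrite /Lam lift_tens //; apply: Lam_multi. Qed.

Lemma Lam_cr x phi : Lam (crF x phi) = icr I x (Lam phi).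
Proof.
have := lift_linear Lam_multi; rewrite -/Lam => lin.
have sumE (F : C * seq H -> fock H) r :
    Lam (\sum_(p <- r) p.1 *: F p) = \sum_(p <- r) p.1 *: Lam (F p).
  elim: r => [|p r IH]; last by rewrite !big_cons lin IH.
  by rewrite !big_nil /=; have := lin (-1) 0 0; rewrite !scaleN1r !addNr.
rewrite [phi]frepP crF_sum; under eq_bigr do rewrite crFZ.
rewrite !sumE linear_sumr; apply: eq_bigr => p _ /=.
by rewrite linearZr_LR crF_tens /Lam !lift_tens //; apply: Lam_multi.
Qed.

Definition fock_isometry (xi : I -> K) : Prop :=
  [/\ forall X Y, '[xi X, xi Y] = '[X, Y],
      xi (ivac I) = vacK H &
      forall n X, ideg n X -> gradeK n (xi X)].

Variable xi : {linear I -> K}.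

(* The domain xi I (+) (xi I)^perp of the adjoint of [xi]. *)
Definition Dadj : set K := [set xi X + Z | X in [set: I] & Z in hortho (range xi)].

(* The adjoint of [xi], meaningful on [Dadj]: see [adjE]. *)
Definition adj (Y : K) : I := xget 0 [set X | hortho (range xi) (Y - xi X)].

Lemma adjE X Z : fock_isometry xi -> hortho (range xi) Z -> adj (xi X + Z) = X.
Proof.
move=> [iso _ _] hZ; rewrite /adj; case: xgetP => [X' _ /= hX'|]; last first.
  by move=> /(_ X)[]; rewrite /= addrC addKr.
apply/esym/subr0_eq/eqP; rewrite -(dnorm_eq0 dotp) -iso linearB /=; apply/eqP.
have := hX' (xi (X - X')); rewrite addrAC dotDl hZ; last by exists (X - X').
by rewrite addr0 linearB => ->//; exists (X - X'); rewrite ?linearB.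
Qed.

(* The domain (H (x) Dadj) (+) C Omega of kappa. *)
Definition Ekap : set K := tensS1 (@crK R H) (vacK H) Dadj.

Definition is_kappa (k : K -> K) : Prop :=
  [/\ Lin Ekap Dadj k, k (vacK H) = vacK H &
      forall x, {in Dadj, k \o crK x =1 xi \o icr I x \o adj}].

Definition fock_map (V W : Type) (vV : V) (gV : nat -> set V) (vW : W)
    (gW : nat -> set W) (f : V -> W) : Prop :=
  f vV = vW /\ forall n X, gV n X -> gW n (f X).

(* Homogeneous elements of degree [n] in a subspace of the completion. *)
Definition homog (S : set K) n : set K := S `&` gradeK n.

Definition alg_mono (Phi : (I -> I) -> (K -> K)) : Prop :=
  [/\ forall a : {linear I -> I}, Lin Dadj Dadj (Phi a),
      forall (c : C) (a b : {linear I -> I}),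
        {in Dadj, Phi (fun X => c *: a X + b X) =1
                  fun Y => c *: Phi a Y + Phi b Y},
      forall a b : {linear I -> I}, {in Dadj, Phi (a \o b) =1 Phi a \o Phi b} &
      forall a b : {linear I -> I}, {in Dadj, Phi a =1 Phi b} -> a =1 b].

(* H^(x)n (x) S and id^(x)n (x) f. *)
Definition tensn n (S : set K) : set K := iter n (tensS (@crK R H)) S.

Fixpoint idtn n (S : set K) (f : K -> K) : K -> K :=
  if n is n'.+1 then idt (@crK R H) (tensn n' S) (idtn n' S f) else f.

(* [kprod k n j] is (id^(n-j) (x) k_j) (id^(n-j+1) (x) k_(j-1)) ... (id^(n-1) (x) k_1) *)
Fixpoint kprod (k : K -> K) n j : K -> K :=
  if j is j'.+1 then idtn (n - j) (homog Ekap j) k \o kprod k n j' else id.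

Definition kappa_fixpoint (k : K -> K) (l : fock H -> K) : Prop :=
  forall phi, l phi = k (idt1 (@crF R H) (vac H) [set: fock H] l phi).

Definition kappa_recursion (k : K -> K) (l : fock H -> K) : Prop :=
  (forall phi, grade 0 phi -> l phi = embed phi) /\
  (forall n phi, grade n.+1 phi -> l phi = k (idt (@crF R H) (grade n) l phi)).

Definition kappa_product (k : K -> K) (l : fock H -> K) : Prop :=
  forall n phi, (0 < n)%N -> grade n phi -> l phi = kprod k n n (embed phi).

End InteractingFock.

(* Main.v *)
Require Import Defs.
From HB Require Import structures.
From mathcomp Require Import all_boot all_order all_algebra.
From mathcomp Require Import sesquilinear complex spectral ring.
From mathcomp Require Import boolp classical_sets functions reals.
Set Implicit Arguments.
Unset Strict Implicit.
Unset Printing Implicit Defensive.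
Import Order.TTheory GRing.Theory Num.Theory Num.Def.
Local Open Scope ring_scope.
Local Open Scope classical_set_scope.

(** The condition on kappa prescribes its values on the elementary tensors:
    x (x) Y must go to xi (a^*(x) (xi^* Y)), which is linear in x and, on the
    domain D of xi^*, linear in Y. So existence and uniqueness of kappa are the
    universal property of the algebraic tensor product H (x) D, and the only
    thing to prove is that this concrete subspace of the completed Fock space
    has it ([tensS_universal]). The reason is orthogonality: if e runs over a
    finite orthonormal system that spans the first factors of an element Z of
    H (x) D, then Z is the sum of the e (x) Y_e, and the inner product of Z with
    e (x) X is that of Y_e with X. Hence Z determines every Y_e, and a relation
    between elementary tensors is respected by every bilinear map.

    That kappa preserves degrees ([kappa_grade]) follows from the same formula.
    The closure of H^(x)n consists of the vectors orthogonal to all words of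
    length other than n ([gradeKP]), so if Z has degree n+1, then each Y_e is
    orthogonal to the words of length other than n and has degree n; and xi^*
    preserves degrees, because a component of xi^* Y in the wrong H_k would be
    orthogonal to itself ([adj_grade]). Everything about a |-> xi a xi^* comes
    from xi^* xi = id and from xi^* being the adjoint of xi on D.

    Since xi^* xi = id, the map lambda = xi Lambda satisfies
    lambda (x (x) w) = kappa (x (x) lambda w). The fixed point equation and the
    recursion say just this about a linear map on words, so induction on words
    identifies their solutions with lambda. The product of the
    id^(n-j) (x) kappa_j applies the same rule to the last letters of a word
    first: after j factors a word u ++ v with j letters in v has become
    u (x) lambda v ([kprod_words]).

    For the failure of adjointability, take I to be the span of a vacuum and one
    more unit vector v, with a^*(x) Omega = phi(x) v and a^*(x) v = 0. Every
    a^*(x) has an adjoint as I has dimension two, whatever the functional phi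
    is. An adjoint of kappa would map xi v to a finite sum of tensors plus a
    multiple of Omega, and pairing that with x (x) Omega would write phi as the
    inner product with a vector of H. The space H is itself an algebraic Fock
    space and phi a functional that is 1 on vectors of arbitrarily high degree,
    so there is no such vector ([coeff_sum_nonrep]). *)

(** * Subspaces and maps that are linear on them *)

Section LinearSubspaces.
Variable R : realType.
Local Notation C := R[i].
Implicit Types V W : preHilbertType R.

Definition subsp V (S : set V) : Prop :=
  S 0 /\ forall (c : C) x y, S x -> S y -> S (c *: x + y).

Definition linear_on V (W : lmodType C) (S : set V) (f : V -> W) : Prop :=
  forall (c : C) x y, S x -> S y -> f (c *: x + y) = c *: f x + f y.

Lemma subspZ V (S : set V) (c : C) x : subsp S -> S x -> S (c *: x).
Proof. by case=> S0 SL Sx; have := SL c _ _ Sx S0; rewrite addr0. Qed.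

Lemma subspD V (S : set V) x y : subsp S -> S x -> S y -> S (x + y).
Proof. by case=> _ SL Sx Sy; have := SL 1 _ _ Sx Sy; rewrite scale1r. Qed.

Lemma subsp_sum V (S : set V) (I : eqType) (r : seq I) (F : I -> V) :
  subsp S -> (forall i, i \in r -> S (F i)) -> S (\sum_(i <- r) F i).
Proof.
move=> sS; elim: r => [|i r IH] h; first by rewrite big_nil; case: sS.
rewrite big_cons; apply: subspD (h _ (mem_head _ _)) _ => //.
by apply: IH => j jr; apply: h; rewrite inE jr orbT.
Qed.

Lemma subspT V : subsp [set: V]. Proof. by []. Qed.

Lemma subsp_hspan V (S : set V) : subsp (hspan S).
Proof. by split; [exact: hspan0 | move=> *; exact: hspan_lin]. Qed.

Lemma subspI V (S T : set V) : subsp S -> subsp T -> subsp (S `&` T).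
Proof.
move=> [S0 SL] [T0 TL]; split=> // c x y [Sx Tx] [Sy Ty].
by split; [apply: SL | apply: TL].
Qed.

Lemma hspan_min V (S T : set V) : subsp T -> S `<=` T -> hspan S `<=` T.
Proof.
move=> sT ST v [s hs ->]; apply: subsp_sum => // p ps.
by apply: subspZ => //; apply/ST/hs.
Qed.

Lemma subsp_hortho V (S : set V) : subsp (hortho S).
Proof.
split=> [|c x y hx hy z Sz]; first by move=> z _; rewrite dot0l.
by rewrite dotDl dotZl hx // hy // mulr0 addr0.
Qed.

(** Continuity of the inner product with [f], by the Cauchy-Schwarz inequality. *)
Lemma hclosure_ortho V (S : set V) f g :
  (forall y, S y -> '[f, y] = 0) -> hclosure S g -> '[f, g] = 0.
Proof.
move=> fS gS; apply/eqP; rewrite -normr_le0 real_leNgt ?real0 ?normr_real //.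
apply/negP => d0; have n0 : 0 < hnorm f + 1 by rewrite ltr_wpDl ?hnorm_ge0.
have [y Sy] := gS _ (divr_gt0 d0 n0); rewrite ltr_pdivlMr // => h.
have: `|'[f, g]| <= hnorm f * hnorm (g - y).
  by apply: le_trans (dot_CS _ _); rewrite dotBr (fS y) // subr0.
have: hnorm f * hnorm (g - y) <= hnorm (g - y) * (hnorm f + 1).
  by rewrite mulrC ler_wpM2l ?hnorm_ge0 // lerDl.
by move=> h1 /le_trans/(_ h1)/le_lt_trans/(_ h); rewrite ltxx.
Qed.

(** The half of Pythagoras' theorem behind best approximation: dropping an
    orthogonal error term brings a vector no further away. *)
Lemma le_hnormB V (x y : V) : '[x, y] = 0 -> hnorm x <= hnorm (x - y).
Proof.
move=> o; rewrite -(ler_pXn2r (n := 2)) ?nnegrE ?hnorm_ge0 // !hnormK.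
by rewrite dotBl !dotBr o [in '[y, x]]dotJ o rmorph0 sub0r opprK subr0 lerDl dot_ge0.
Qed.

Section LinearOn.
Variables (V : preHilbertType R) (W : lmodType C) (S : set V) (f : V -> W).
Hypotheses (sS : subsp S) (fL : linear_on S f).

Lemma linear_on0 : f 0 = 0.
Proof. by have := fL (-1) sS.1 sS.1; rewrite !scaleN1r !addNr. Qed.

Lemma linear_onZ c x : S x -> f (c *: x) = c *: f x.
Proof. by move=> Sx; have := fL c Sx sS.1; rewrite linear_on0 !addr0. Qed.

Lemma linear_onD x y : S x -> S y -> f (x + y) = f x + f y.
Proof. by move=> Sx Sy; have := fL 1 Sx Sy; rewrite !scale1r. Qed.

Lemma linear_on_sum (I : eqType) (r : seq I) (F : I -> V) :
  (forall i, i \in r -> S (F i)) -> f (\sum_(i <- r) F i) = \sum_(i <- r) f (F i).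
Proof.
elim: r => [|i r IH] h; first by rewrite !big_nil linear_on0.
have hr j : j \in r -> S (F j) by move=> jr; apply: h; rewrite inE jr orbT.
rewrite !big_cons linear_onD ?IH //; first exact: h (mem_head _ _).
exact: subsp_sum.
Qed.

End LinearOn.

Lemma linear_on_hspan V (W : lmodType C) (S T : set V) (f g : V -> W) :
  subsp S -> linear_on S f -> linear_on S g -> T `<=` S ->
  (forall x, T x -> f x = g x) -> forall x, hspan T x -> f x = g x.
Proof.
move=> sS fL gL TS fg x.
have sE : subsp (S `&` [set x | f x = g x]).
  split=> [|c y z [Sy fy] [Sz fz]].
    by split; [exact: sS.1 | rewrite /= (linear_on0 sS fL) (linear_on0 sS gL)].
  by split; [exact: sS.2 | rewrite /= fL ?gL // fy fz].
have TE : T `<=` S `&` [set x | f x = g x].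
  by move=> y Ty; split; [exact: TS | exact: fg].
by move=> /(hspan_min sE TE)[].
Qed.
End LinearSubspaces.

(** * The universal property of an algebraic tensor product *)

Section TensorProducts.
Variables (R : realType) (H V : preHilbertType R).
Local Notation C := R[i].

Definition bilinear_on (W : lmodType C) (S : set V) (B : H -> V -> W) : Prop :=
  (forall Y, S Y -> linear_on [set: H] (B^~ Y)) /\ (forall x, linear_on S (B x)).

(** The coordinates of a tensor along a finite system [es] do not depend on the
    bilinear map into which it is fed. This is what allows a relation to be
    transferred from [cr] to [B]. *)
Lemma bilinear_on_expand (W : lmodType C) (S : set V) (B : H -> V -> W)
    (es : seq H) (s : seq (H * V)) :
  subsp S -> bilinear_on S B -> (forall p, p \in s -> S p.2) ->
  (forall p, p \in s -> p.1 = \sum_(e <- es) '[p.1, e] *: e) ->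
  \sum_(p <- s) B p.1 p.2 = \sum_(e <- es) B e (\sum_(p <- s) '[p.1, e] *: p.2).
Proof.
move=> sS [Bl Br] hs hes.
transitivity (\sum_(p <- s) \sum_(e <- es) '[p.1, e] *: B e p.2).
  apply: eq_big_seq => p ps; rewrite {1}(hes p ps).
  have BL := Bl _ (hs p ps).
  apply: etrans (linear_on_sum (subspT H) BL _) _ => //.
  by apply: eq_bigr => e _; apply: (linear_onZ (subspT H) BL).
rewrite exchange_big; apply: eq_bigr => e _ /=.
rewrite (linear_on_sum sS (Br e)); last by move=> p /hs; apply: subspZ.
by apply: eq_big_seq => p /hs Sp; rewrite (linear_onZ sS (Br e)).
Qed.

Variable cr : {bilinear H -> V -> V}.
Hypothesis cr_dot : forall x y X Y, '[cr x X, cr y Y] = '[x, y] * '[X, Y].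

Lemma cr_bilinear_on S : bilinear_on S cr.
Proof.
by split=> [Y _ c x y _ _|x c X Y _ _] /=; [exact: linearPl | exact: linearPr].
Qed.

Lemma tensS_cr (S : set V) x Y : S Y -> tensS cr S (cr x Y).
Proof. by move=> SY; apply: hspan_sub; exists x => //; exists Y. Qed.

(** The inner product sees the coordinates one at a time, so that they are
    determined by the tensor. *)
Lemma cr_coord_dot (es : seq H) (Y : H -> V) e X :
  uniq es -> {in es &, forall e e', '[e, e'] = (e == e')%:R} -> e \in es ->
  '[\sum_(e' <- es) cr e' (Y e'), cr e X] = '[Y e, X].
Proof.
move=> ues oes ein; rewrite dot_suml (bigD1_seq e) //= cr_dot oes // eqxx mul1r.
rewrite big1_seq ?addr0 // => e' /andP[ne e'in].
by rewrite cr_dot oes // (negPf ne) mul0r.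
Qed.

Lemma tensS_orthonormal S Z : subsp S -> tensS cr S Z -> exists es (Y : H -> V),
  [/\ uniq es, {in es &, forall e e', '[e, e'] = (e == e')%:R},
      forall e, S (Y e) & Z = \sum_(e <- es) cr e (Y e)].
Proof.
move=> sS /tensSP[s hs ->].
have [es [ues oes hes]] := orthonormal_basis [seq p.1 | p <- s].
exists es, (fun e => \sum_(p <- s) '[p.1, e] *: p.2); split=> //.
  by move=> e; apply: subsp_sum => // p /hs; apply: subspZ.
apply: bilinear_on_expand (cr_bilinear_on S) hs _ => // p ps.
by apply: hes; apply/mapP; exists p.
Qed.

(** Expanded along an orthonormal system, a vanishing sum of tensors has only
    vanishing coordinates, and [B] maps these to 0. *)
Lemma tensS_indep (W : lmodType C) S (B : H -> V -> W) (s : seq (H * V)) :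
  subsp S -> bilinear_on S B -> (forall p, p \in s -> S p.2) ->
  \sum_(p <- s) cr p.1 p.2 = 0 -> \sum_(p <- s) B p.1 p.2 = 0.
Proof.
move=> sS bB hs s0; have [es [ues oes hes]] := orthonormal_basis [seq p.1 | p <- s].
have hes' p : p \in s -> p.1 = \sum_(e <- es) '[p.1, e] *: e.
  by move=> ps; apply: hes; apply/mapP; exists p.
rewrite (bilinear_on_expand sS bB hs hes') big1_seq // => e /= ein.
rewrite (_ : \sum_(p <- s) _ = 0); first by rewrite (linear_on0 sS (bB.2 e)).
move: s0; rewrite (bilinear_on_expand sS (cr_bilinear_on S) hs hes').
set Y := fun e => \sum_(p <- s) '[p.1, e] *: p.2 => s0.
apply/eqP; rewrite -(dnorm_eq0 dotp) -/(Y e); apply/eqP.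
by rewrite -(cr_coord_dot Y (Y e) ues oes ein) s0 dot0l.
Qed.

(** The graph of [T] is the set [r] of pairs of sums with a common list of
    tensor factors; [tensS_indep] makes it single-valued. *)
Lemma tensS_universal (W : lmodType C) S (B : H -> V -> W) :
  subsp S -> bilinear_on S B -> exists T : V -> W,
  linear_on (tensS cr S) T /\ forall x Y, S Y -> T (cr x Y) = B x Y.
Proof.
move=> sS bB; pose r Z (w : W) := exists2 s : seq (H * V),
  forall p, p \in s -> S p.2 &
  Z = \sum_(p <- s) cr p.1 p.2 /\ w = \sum_(p <- s) B p.1 p.2.
have rP Z Z' w w' c : r Z w -> r Z' w' -> r (c *: Z + Z') (c *: w + w').
  move=> [s hs [-> ->]] [t ht [-> ->]].
  exists ([seq (p.1, c *: p.2) | p <- s] ++ t).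
    move=> p; rewrite mem_cat => /orP[/mapP[q qs ->]|]; last exact: ht.
    by apply: subspZ (hs q qs).
  rewrite !big_cat !big_map !scaler_sumr /=; split; congr (_ + _).
    by apply: eq_bigr => p _; rewrite linearZr_LR.
  by apply: eq_big_seq => p ps; rewrite (linear_onZ sS (bB.2 p.1)) //; apply: hs.
have r0 w : r 0 w -> w = 0.
  by move=> [s hs [Z0 ->]]; apply: tensS_indep hs _.
have rU Z w w' : r Z w -> r Z w' -> w = w'.
  move=> h h'; apply/esym/subr0_eq; rewrite addrC; apply: r0.
  by have := rP _ _ _ _ (-1) h h'; rewrite !scaleN1r addNr.
have rT Z : tensS cr S Z -> exists w, r Z w.
  by move=> /tensSP[s hs ->]; exists (\sum_(p <- s) B p.1 p.2), s.
pose T Z : W := xget 0 [set w | r Z w].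
have TE Z w : r Z w -> T Z = w.
  by move=> h; rewrite /T; case: xgetP => [w' _ /rU/(_ h)//|/(_ w)].
exists T; split=> [c Z Z' /rT[w h] /rT[w' h']|x Y SY].
  by rewrite (TE _ _ h) (TE _ _ h'); apply/TE/rP.
apply: TE; exists [:: (x, Y)]; last by rewrite !big_seq1.
by move=> p; rewrite inE => /eqP->.
Qed.

End TensorProducts.

(** * Degrees in the completed Fock space *)

Section Grading.
Variables (R : realType) (H : preHilbertType R).
Local Notation C := R[i].
Local Notation K := (fullfock H).
Implicit Types (f g : K) (w : seq H) (x : H).

Lemma fock_hspan (phi : fock H) : hspan (range (@tens R H)) phi.
Proof.
have [s ->] := fockP phi; exists [seq (p.1, tens p.2) | p <- s].
  by move=> _ /mapP[p _ ->]; exists p.2.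
by rewrite big_map.
Qed.

Lemma grade_tens w : grade (size w) (tens w).
Proof. by apply: hspan_sub; exists w. Qed.

Lemma embed_tens_cons x w : embed (tens (x :: w)) = crK x (embed (tens w)).
Proof. by rewrite crK_embed crF_tens. Qed.

Lemma embed_tens w : embed (tens w) = foldr (@crK R H) (vacK H) w.
Proof. by elim: w => [//|x w IH]; rewrite embed_tens_cons IH. Qed.

Lemma grade_orth m w phi : grade m phi -> size w != m -> '[phi, tens w] = 0.
Proof.
move=> [s hs ->] wm; rewrite dot_suml big1_seq // => p /= /hs[v vm <-].
by rewrite dotZl tens_dot kdot_size ?mulr0 // vm eq_sym.
Qed.

Lemma dot_embed_sum f (s : seq (C * fock H)) :
  '[f, embed (\sum_(p <- s) p.1 *: p.2)] =
  \sum_(p <- s) (p.1)^* * '[f, embed p.2].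
Proof.
have -> : embed (\sum_(p <- s) p.1 *: p.2) = \sum_(p <- s) p.1 *: embed p.2.
  by rewrite linear_sum; apply: eq_bigr => p _; apply: linearZ.
by rewrite dot_sumr; apply: eq_bigr => p _; apply: dotZr.
Qed.

(** Orthogonality to the other words is a closed condition. Conversely, discard
    from an approximation of [f] all words of the wrong length: they are
    orthogonal both to [f] and to what remains, so that the approximation only
    gets better. *)
Lemma gradeKP n f :
  gradeK n f <-> forall w, size w != n -> '[f, embed (tens w)] = 0.
Proof.
split=> [fn w wn|fo e e0].
  rewrite dotJ (hclosure_ortho _ fn) ?rmorph0 // => _ [phi hphi <-].
  by rewrite embed_dot dotJ (grade_orth hphi) ?rmorph0.
have [_ [phi _ <-] hf] := embed_dense f e0.
have [s hs E] := fock_hspan phi.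
pose deg (p : C * fock H) := `[< grade n p.2 >].
pose phi_n := \sum_(p <- [seq p <- s | deg p]) p.1 *: p.2.
pose rho := \sum_(p <- [seq p <- s | ~~ deg p]) p.1 *: p.2.
have phiE : phi = phi_n + rho by rewrite E (bigID deg) /phi_n /rho !big_filter.
have gn : grade n phi_n.
  apply: subsp_sum (subsp_hspan _) _ => p; rewrite mem_filter => /andP[/asboolP h _].
  exact: subspZ (subsp_hspan _) h.
exists (embed phi_n); first by exists phi_n.
have o : '[f - embed phi_n, embed rho] = 0.
  rewrite /rho dot_embed_sum big1_seq // => p /andP[_].
  rewrite mem_filter => /andP[np /hs[w _ wp]].
  have wn : size w != n.
    by apply: contra np => /eqP wn; rewrite /deg -wp -wn; apply/asboolP/grade_tens.
  by rewrite -wp dotBl fo // embed_dot (grade_orth gn) // subrr mulr0.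
apply: le_lt_trans hf; have -> : f - embed phi = f - embed phi_n - embed rho.
  by rewrite phiE linearD opprD addrA.
exact: le_hnormB o.
Qed.

Lemma subsp_gradeK n : subsp (@gradeK R H n).
Proof.
split; first by apply/gradeKP => w _; rewrite dot0l.
move=> c f g /gradeKP hf /gradeKP hg; apply/gradeKP => w wn.
by rewrite dotDl dotZl hf // hg // mulr0 addr0.
Qed.

Lemma gradeK_embed n phi : grade n phi -> @gradeK R H n (embed phi).
Proof.
by move=> h; apply/gradeKP => w wn; rewrite embed_dot (grade_orth h).
Qed.

Lemma gradeK_orth m n f g : m != n -> gradeK m f -> gradeK n g -> '[f, g] = 0.
Proof.
move=> mn /gradeKP hf; apply: hclosure_ortho => _ [phi hphi <-].
have [s hs ->] := hphi; rewrite dot_embed_sum big1_seq // => p /= /hs.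
by case=> v /= vn <-; rewrite hf ?mulr0 // vn eq_sym.
Qed.

Lemma gradeK_crK n x f : gradeK n f -> gradeK n.+1 (crK x f).
Proof.
move=> /gradeKP hf; apply/gradeKP => -[|y w] wn.
  by rewrite dotJ crK_vac rmorph0.
by rewrite embed_tens_cons crK_dot hf ?mulr0.
Qed.

Lemma ortho_words0 f : (forall w, '[f, embed (tens w)] = 0) -> f = 0.
Proof.
move=> h; apply/eqP; rewrite -(dnorm_eq0 dotp); apply/eqP.
apply: hclosure_ortho (embed_dense f) => _ [phi _ <-].
have [s hs ->] := fock_hspan phi; rewrite dot_embed_sum big1_seq // => p /= /hs.
by case=> w _ <-; rewrite h mulr0.
Qed.

Lemma gradeK_vac : @gradeK R H 0 (vacK H).
Proof. exact: gradeK_embed (grade_tens [::]). Qed.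

Lemma tensS_vac (S : set K) Z : tensS (@crK R H) S Z -> '[Z, vacK H] = 0.
Proof.
move=> /tensSP[s _ ->]; rewrite dot_suml big1 // => p _.
by rewrite dotJ crK_vac rmorph0.
Qed.

End Grading.

(** * The adjoint of an embedding *)

Section Adjoint.
Variables (R : realType) (H : preHilbertType R) (I : interacting_fock H).
Variable xi : {linear I -> fullfock H}.
Hypothesis xiP : fock_isometry xi.
Local Notation C := R[i].
Local Notation K := (fullfock H).
Local Notation D := (Dadj xi).
Local Notation om := (vacK H).
Implicit Types (X : I) (Y : K).

Lemma xi_dot X X' : '[xi X, xi X'] = '[X, X'].
Proof. by case: xiP. Qed.

Lemma xi_vac : xi (ivac I) = om.
Proof. by case: xiP. Qed.

Lemma xi_grade n X : ideg n X -> @gradeK R H n (xi X).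
Proof. by case: xiP => _ _; apply. Qed.

Lemma xi_inj : injective xi.
Proof.
move=> X X' E; apply/subr0_eq/eqP; rewrite -(dnorm_eq0 dotp) -xi_dot.
by rewrite linearB /= E subrr dot0l.
Qed.

Lemma subsp_ideg n : subsp (@ideg R H I n).
Proof.
case: n => [|n]; last by rewrite icr_span; apply: subsp_hspan.
rewrite ideg0; split; first by exists 0; rewrite ?scale0r.
move=> c _ _ [a _ <-] [b _ <-]; exists (c * a + b) => //.
by rewrite scalerDl scalerA.
Qed.

Lemma ideg_icr n x X : ideg n X -> ideg n.+1 (icr I x X).
Proof. by rewrite icr_span; apply: tensS_cr. Qed.

Lemma DadjP Y : D Y -> exists X Z, hortho (range xi) Z /\ Y = xi X + Z.
Proof. by move=> [X _ [Z hZ <-]]; exists X, Z. Qed.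

Lemma Dadj_xi X : D (xi X).
Proof.
by exists X => //; exists 0; rewrite ?addr0 // => y _; rewrite dot0l.
Qed.

Lemma subsp_Dadj : subsp D.
Proof.
split; first by rewrite -(linear0 xi); apply: Dadj_xi.
move=> c _ _ [X _ [Z hZ <-]] [X' _ [Z' hZ' <-]].
exists (c *: X + X') => //; exists (c *: Z + Z').
  exact: (subsp_hortho _).2.
by rewrite linearP scalerDr addrACA.
Qed.

Lemma adj_linear : linear_on D (adj xi).
Proof.
move=> c _ _ [X _ [Z hZ <-]] [X' _ [Z' hZ' <-]].
rewrite !adjE // scalerDr addrACA -linearP adjE //.
exact: (subsp_hortho _).2.
Qed.

Lemma adj_xi X : adj xi (xi X) = X.
Proof.
by rewrite -[xi X]addr0 adjE // => y _; rewrite dot0l.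
Qed.

Lemma adj_vac : adj xi om = ivac I.
Proof. by rewrite -xi_vac adj_xi. Qed.

Lemma Dadj_vac : D om.
Proof. by rewrite -xi_vac; apply: Dadj_xi. Qed.

Lemma adj_dot X Y : D Y -> '[xi X, Y] = '[X, adj xi Y].
Proof.
move=> /DadjP[X' [Z [hZ ->]]]; rewrite adjE // dotDr xi_dot.
by rewrite [in '[_, Z]]dotJ hZ ?rmorph0 ?addr0 //; exists X.
Qed.

(** If k differs from n, then the component F_k of xi^* Y satisfies
    <F_k, F_k> = <F_k, xi^* Y> = <xi F_k, Y> = 0, as xi F_k has degree k and Y
    has degree n. *)
Lemma adj_grade n Y : D Y -> gradeK n Y -> ideg n (adj xi Y).
Proof.
move=> DY gY; have [N [F [hF E]]] := ideg_sum (adj xi Y).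
have F0 k : (k < N)%N -> k != n -> F k = 0.
  move=> kN kn; apply/eqP; rewrite -(dnorm_eq0 dotp); apply/eqP.
  have <- : '[F k, adj xi Y] = '[F k, F k].
    rewrite E dot_sumr (bigD1 (Ordinal kN)) //= big1 ?addr0 // => i ik.
    apply: ideg_ortho (hF k) (hF i) => /esym ki.
    by move/eqP: ik; apply; apply: val_inj.
  by rewrite -adj_dot // (gradeK_orth kn (xi_grade (hF k))).
rewrite E; apply: subsp_sum (subsp_ideg n) _ => i _.
have [<-//|ni] := eqVneq (i : nat) n.
by rewrite F0 //; case: (subsp_ideg n).
Qed.

End Adjoint.

(** * The map Lambda on words *)

Section LambdaMap.
Variables (R : realType) (H : preHilbertType R) (I : interacting_fock H).
Local Notation C := R[i].

Lemma linear_on_words (W : lmodType C) (f g : fock H -> W) :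
  linear_on [set: fock H] f -> linear_on [set: fock H] g ->
  (forall w, f (tens w) = g (tens w)) -> f =1 g.
Proof.
move=> fL gL fg phi; apply: (linear_on_hspan (subspT _) fL gL) (fock_hspan phi) => //.
by move=> _ [w _ <-].
Qed.

Lemma Lam_linear : linear_on [set: fock H] (@Lam R H I).
Proof. by move=> c phi psi _ _; apply: lift_linear (Lam_multi I) _ _ _. Qed.

Lemma Lam_tens w : Lam I (tens w) = foldr (icr I) (ivac I) w.
Proof. exact: lift_tens (Lam_multi I). Qed.

Lemma Lam_grade n phi : grade n phi -> ideg n (Lam I phi).
Proof.
move=> [s hs ->]; rewrite (linear_on_sum (subspT _) Lam_linear) //.
apply: subsp_sum (subsp_ideg I n) _ => p /hs[w <- <-].
rewrite (linear_onZ (subspT _) Lam_linear) // Lam_tens.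
apply: subspZ (subsp_ideg I _) _; elim: w => [|x w IH] /=; last exact: ideg_icr.
by rewrite ideg0; exists 1; rewrite ?scale1r.
Qed.

Lemma vac_crF x (phi : fock H) : '[vac H, crF x phi] = 0.
Proof.
have [s hs ->] := fock_hspan phi; rewrite crF_sum dot_sumr big1_seq // => p /= /hs.
by case=> w _ <-; rewrite crFZ dotZr crF_tens tens_dot mulr0.
Qed.

Lemma vac_unit : '[vac H, vac H] = 1.
Proof. exact: tens_dot. Qed.

Lemma fock_tensS1 (phi : fock H) : tensS1 (@crF R H) (vac H) [set: fock H] phi.
Proof.
have [s -> {phi}] := fockP phi; elim: s => [|[c w] s [Z hZ [b _ E]]].
  exists 0; last by exists 0 => //; rewrite big_nil scale0r addr0.
  exact: hspan0.
rewrite big_cons /= -E; case: w => [|x w].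
  by exists Z => //; exists (c + b) => //; rewrite scalerDl addrCA.
exists (c *: tens (x :: w) + Z); last by exists b => //; rewrite addrA.
by apply: hspan_lin => //; rewrite -crF_tens; apply: tensS_cr.
Qed.

End LambdaMap.

(** * Tensor maps with an identity factor *)

Section TensorMapsOnSubspaces.
Variables (R : realType) (H V : preHilbertType R).
Local Notation C := R[i].
Local Notation K := (fullfock H).
Variable cr : {bilinear H -> V -> V}.
Hypothesis cr_dot : forall x y X Y, '[cr x X, cr y Y] = '[x, y] * '[X, Y].
Variables (S : set V) (f : V -> K).
Hypotheses (sS : subsp S) (fL : linear_on S f).

Lemma idt_linear_on : linear_on (tensS cr S) (idt cr S f).
Proof. by move=> c Z Z'; apply: (idt_lin cr_dot sS.1 sS.2 fL). Qed.

Lemma idt_tensor x Y : S Y -> idt cr S f (cr x Y) = crK x (f Y).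
Proof. exact: (idt_cr cr_dot sS.1 sS.2 fL). Qed.

Lemma idt_tensS (T : set K) Z : (forall Y, S Y -> T (f Y)) ->
  tensS cr S Z -> tensS (@crK R H) T (idt cr S f Z).
Proof.
move=> fT /tensSP[s hs ->]; rewrite (idtE cr_dot sS.1 sS.2 fL) //.
by apply: subsp_sum (subsp_hspan _) _ => p /hs/fT; apply: tensS_cr.
Qed.

End TensorMapsOnSubspaces.

Section IteratedTensorMaps.
Variables (R : realType) (H : preHilbertType R).
Local Notation K := (fullfock H).
Variables (S : set K) (f : K -> K).
Hypotheses (sS : subsp S) (fL : linear_on S f).

Lemma subsp_tensn n : subsp (tensn n S).
Proof. by case: n => // n; apply: subsp_hspan. Qed.

Lemma tensn_foldr u Y : S Y -> tensn (size u) S (foldr (@crK R H) Y u).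
Proof. by move=> SY; elim: u => //= x u; apply: tensS_cr. Qed.

Lemma idtn_linear_on n : linear_on (tensn n S) (idtn n S f).
Proof.
elim: n => [//|n IH].
exact: (idt_linear_on (@crK_dot R H) (subsp_tensn n) IH).
Qed.

Lemma idtn_foldr u Y : S Y ->
  idtn (size u) S f (foldr (@crK R H) Y u) = foldr (@crK R H) (f Y) u.
Proof.
move=> SY; elim: u => [//|x u IH] /=; rewrite -IH.
have := idt_tensor (@crK_dot R H) (subsp_tensn (size u)) (@idtn_linear_on (size u)).
by apply; apply: tensn_foldr.
Qed.

End IteratedTensorMaps.

(** * The map kappa and the recovery of lambda *)

Section Kappa.
Variables (R : realType) (H : preHilbertType R) (I : interacting_fock H).
Variable xi : {linear I -> fullfock H}.
Hypothesis xiP : fock_isometry xi.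
Local Notation C := R[i].
Local Notation K := (fullfock H).
Local Notation D := (Dadj xi).
Local Notation E := (Ekap xi).
Local Notation om := (vacK H).
Local Notation lam := (xi \o @Lam R H I).
Implicit Types (X : I) (Y Z : K).

Lemma Ekap_tensS Z : tensS (@crK R H) D Z -> E Z.
Proof. by move=> hZ; exists Z => //; exists 0; rewrite ?scale0r ?addr0. Qed.

Lemma Ekap_crK x Y : D Y -> E (crK x Y).
Proof. by move=> DY; apply/Ekap_tensS/tensS_cr. Qed.

Lemma Ekap_vac : E om.
Proof.
by exists 0; [exact: hspan0 | exists 1; rewrite ?scale1r ?add0r].
Qed.

Lemma subsp_Ekap : subsp E.
Proof.
split; first exact/Ekap_tensS/hspan0.
move=> c _ _ [Z hZ [a _ <-]] [Z' hZ' [b _ <-]].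
exists (c *: Z + Z'); first exact: hspan_lin.
by exists (c * a + b) => //; rewrite scalerDr scalerA scalerDl addrACA.
Qed.

(** The universal property gives the map [T] on H (x) D. The coefficient of
    Omega in an element of (H (x) D) (+) C Omega is its inner product with Omega,
    which extends [T] to this direct sum. *)
Lemma kappa_exists : exists k, is_kappa xi k.
Proof.
have bB : bilinear_on D (fun x Y => xi (icr I x (adj xi Y))).
  split=> [Y _ c x y _ _|x c Y Y' DY DY'] /=.
    by rewrite linearPl linearP.
  by rewrite (adj_linear xiP) // linearPr linearP.
have [T [TL TE]] := tensS_universal (@crK_dot R H) (subsp_Dadj xi) bB.
have [k kE] : exists k : K -> K, forall Z c, tensS (@crK R H) D Z ->
    k (Z + c *: om) = T Z + c *: om.
  exists (fun Z => T (Z - '[Z, om] *: om) + '[Z, om] *: om) => Z c hZ.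
  have -> : '[Z + c *: om, om] = c.
    by rewrite dotDl dotZl (tensS_vac hZ) vacK_unit mulr1 add0r.
  by rewrite addrK.
have T0 : T 0 = 0 by apply: linear_on0 TL; apply: subsp_hspan.
have TD Z : tensS (@crK R H) D Z -> D (T Z).
  move=> /tensSP[s hs ->].
  rewrite (linear_on_sum (subsp_hspan _) TL) => [|p /hs]; last exact: tensS_cr.
  apply: subsp_sum (subsp_Dadj xi) _ => p /hs DY.
  by rewrite TE //; apply: Dadj_xi.
exists k; split; first split.
- move=> c _ _ [Z hZ [a _ <-]] [Z' hZ' [b _ <-]].
  have -> : c *: (Z + a *: om) + (Z' + b *: om) =
      c *: Z + Z' + (c * a + b) *: om.
    by rewrite scalerDr scalerA scalerDl addrACA.
  rewrite (kE _ _ hZ) (kE _ _ hZ') kE; last exact: hspan_lin.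
  by rewrite TL // scalerDr scalerA scalerDl addrACA.
- move=> _ [Z hZ [a _ <-]]; rewrite (kE _ _ hZ).
  apply: subspD (subsp_Dadj xi) (TD _ hZ) _.
  by apply: subspZ (subsp_Dadj xi) _; apply: Dadj_vac.
- by have := kE 0 1 (hspan0 _); rewrite scale1r add0r T0 add0r.
- move=> x Y; rewrite inE => DY.
  have := kE (crK x Y) 0 (tensS_cr _ x DY).
  by rewrite scale0r !addr0 TE.
Qed.

Section WithKappa.
Variable k : K -> K.
Hypothesis kP : is_kappa xi k.

Lemma kappa_linear : linear_on E k.
Proof. by case: kP => [[]]. Qed.

Lemma kappa_Dadj Z : E Z -> D (k Z).
Proof. by case: kP => [[_ kD] _ _]; apply: kD. Qed.

Lemma kappa_vac : k om = om.
Proof. by case: kP. Qed.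

Lemma kappa_crK x Y : D Y -> k (crK x Y) = xi (icr I x (adj xi Y)).
Proof. by case: kP => _ _ h DY; apply: h; rewrite inE. Qed.

Lemma kappa_unique k' : is_kappa xi k' -> {in E, k' =1 k}.
Proof.
move=> kP' Z; rewrite inE => -[Z' hZ' [c _ <-]].
case: kP' => [[k'L _] k'v k'x].
have EZ := Ekap_tensS hZ'; have Eo : E (c *: om).
  by apply: subspZ subsp_Ekap Ekap_vac.
rewrite (linear_onD k'L EZ Eo) (linear_onD kappa_linear EZ Eo).
rewrite (linear_onZ subsp_Ekap k'L c Ekap_vac).
rewrite (linear_onZ subsp_Ekap kappa_linear c Ekap_vac).
rewrite k'v kappa_vac; congr (_ + _).
apply: (linear_on_hspan subsp_Ekap k'L kappa_linear) hZ'.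
  by move=> _ [x _ [Y DY <-]]; apply: Ekap_crK.
move=> _ [x _ [Y DY <-]]; rewrite kappa_crK //.
by apply: k'x; rewrite inE.
Qed.

(** The coordinate [Y e] of an element of degree n+1 has inner product with a
    word w equal to that of the element with e :: w, hence has degree n. For an
    element of degree 0 these inner products all vanish, and only the multiple
    of Omega is left. *)
Lemma kappa_grade n Z : E Z -> gradeK n Z -> gradeK n (k Z).
Proof.
move=> [Z' hZ' [c _ <-]] gZ.
have [es [Y [ues oes DY E']]] := tensS_orthonormal (subsp_Dadj xi) hZ'.
have coord e w : e \in es ->
    '[Y e, embed (tens w)] = '[Z' + c *: om, embed (tens (e :: w))].
  move=> ein; rewrite dotDl dotZl embed_tens_cons crK_vac mulr0 addr0 E'.
  by rewrite (cr_coord_dot (@crK_dot R H)).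
have EZ := Ekap_tensS hZ'; have Eo : E (c *: om).
  by apply: subspZ subsp_Ekap Ekap_vac.
rewrite (linear_onD kappa_linear EZ Eo).
rewrite (linear_onZ subsp_Ekap kappa_linear c Ekap_vac) kappa_vac.
case: n gZ => [|n] /gradeKP gZ.
  suff -> : Z' = 0.
    rewrite (linear_on0 subsp_Ekap kappa_linear) add0r.
    by apply: subspZ (subsp_gradeK _ _) (gradeK_vac H).
  rewrite E' big1_seq // => e /= ein; rewrite (_ : Y e = 0) ?linear0r //.
  by apply: ortho_words0 => w; rewrite coord ?gZ.
have c0 : c = 0.
  have := gZ [::]; rewrite dotDl (tensS_vac hZ') dotZl vacK_unit mulr1 add0r.
  exact.
rewrite c0 scale0r addr0 E' (linear_on_sum subsp_Ekap kappa_linear); last first.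
  by move=> e _; apply: Ekap_crK.
apply: subsp_sum (subsp_gradeK _ _) _ => e ein; rewrite kappa_crK //.
apply: (xi_grade xiP); apply: ideg_icr; apply: (adj_grade xiP) => //.
by apply/gradeKP => w wn; rewrite coord ?gZ.
Qed.

Lemma lam_linear : linear_on [set: fock H] lam.
Proof. by move=> c f g _ _ /=; rewrite Lam_linear // linearP. Qed.

Lemma lam_Dadj phi : D (lam phi).
Proof. exact: Dadj_xi. Qed.

Lemma lam_vac : lam (vac H) = om.
Proof. by rewrite /= Lam_vac xi_vac. Qed.

Lemma lam_grade n phi : grade n phi -> gradeK n (lam phi).
Proof. by move=> /(Lam_grade I); apply: (xi_grade xiP). Qed.

(** The identity behind all three characterizations of lambda; it holds because
    xi^* undoes the xi in lambda. *)
Lemma lam_cons x w : lam (tens (x :: w)) = k (crK x (lam (tens w))).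
Proof.
by rewrite kappa_crK; [rewrite /= (adj_xi xiP) -crF_tens Lam_cr | exact: lam_Dadj].
Qed.

Section Uniqueness.
Variable l : fock H -> K.
Hypotheses (lL : linear_on [set: fock H] l) (lD : forall phi, D (l phi)).
Local Notation one_l := (idt1 (@crF R H) (vac H) [set: fock H] l).

Lemma idt1_fock (Z : fock H) (c : C) : tensS (@crF R H) [set: fock H] Z ->
  one_l (Z + c *: vac H) = idt (@crF R H) [set: fock H] l Z + c *: om.
Proof.
exact: (idt1E (@vac_crF R H) (vac_unit H)).
Qed.

Lemma idt1_linear : linear_on [set: fock H] one_l.
Proof.
move=> c phi psi _ _.
have [Z hZ [a _ <-]] := fock_tensS1 phi; have [Z' hZ' [b _ <-]] := fock_tensS1 psi.
rewrite [c *: (_ + _) + _](_ : _ = c *: Z + Z' + (c * a + b) *: vac H); last first.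
  by rewrite scalerDr scalerA scalerDl addrACA.
rewrite !idt1_fock //; last exact: hspan_lin.
rewrite (idt_linear_on (@crF_dot R H) (subspT _) lL) //.
by rewrite scalerDr scalerA scalerDl addrACA.
Qed.

Lemma idt1_Ekap phi : E (one_l phi).
Proof.
have [Z hZ [a _ <-]] := fock_tensS1 phi; rewrite idt1_fock //.
exists (idt (@crF R H) [set: fock H] l Z); last by exists a.
by apply: (idt_tensS (@crF_dot R H) (subspT _) lL).
Qed.

Lemma idt1_vac : one_l (vac H) = om.
Proof.
have := @idt1_fock 0 1 (hspan0 _); rewrite add0r !scale1r => ->.
rewrite (linear_on0 _ (idt_linear_on (@crF_dot R H) (subspT _) lL)) ?add0r //.
exact: subsp_hspan.
Qed.

Lemma idt1_cons x w : one_l (tens (x :: w)) = crK x (l (tens w)).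
Proof.
have hZ : tensS (@crF R H) [set: fock H] (tens (x :: w)).
  by rewrite -crF_tens; apply: tensS_cr.
have := idt1_fock 0 hZ; rewrite !scale0r !addr0 => ->.
by rewrite -crF_tens (idt_tensor (@crF_dot R H) (subspT _) lL).
Qed.

(** All three uniqueness statements reduce to a rule for adding one letter. *)
Lemma eq_lam : l (vac H) = om ->
  (forall x w, l (tens w) = lam (tens w) -> l (tens (x :: w)) = lam (tens (x :: w))) ->
  l =1 lam.
Proof.
move=> lv lc; apply: linear_on_words lL lam_linear _ => w.
by elim: w => [|x w IH]; [rewrite [LHS]lv lam_vac | apply: lc].
Qed.

Lemma kappa_fixpoint_eq : kappa_fixpoint k l -> l =1 lam.
Proof.
move=> fp; apply: eq_lam => [|x w IH].
  by rewrite fp idt1_vac kappa_vac.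
by rewrite fp idt1_cons IH lam_cons.
Qed.

Lemma kappa_recursion_eq : kappa_recursion k l -> l =1 lam.
Proof.
move=> [r0 rS]; apply: eq_lam => [|x w IH]; first exact: r0 (grade_tens [::]).
rewrite (rS (size w)); last exact: grade_tens (x :: w).
rewrite -[tens (x :: w) in LHS]crF_tens (idt_tensor (@crF_dot R H)).
- by rewrite IH lam_cons.
- exact: subsp_hspan.
- by move=> c phi psi _ _; apply: lL.
- exact: grade_tens.
Qed.

End Uniqueness.

Lemma lam_fixpoint : kappa_fixpoint k lam.
Proof.
pose one_lam := idt1 (@crF R H) (vac H) [set: fock H] lam.
have oE phi : E (one_lam phi) by apply: idt1_Ekap lam_linear lam_Dadj phi.
have gL : linear_on [set: fock H] (k \o one_lam).
  move=> c phi psi _ _ /=; rewrite /one_lam (idt1_linear lam_linear) //.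
  exact: kappa_linear (oE phi) (oE psi).
apply: linear_on_words lam_linear gL _ => -[|x w].
  by rewrite [RHS]/= /one_lam (idt1_vac lam_linear) kappa_vac lam_vac.
by rewrite [RHS]/= /one_lam (idt1_cons lam_linear) lam_cons.
Qed.

Lemma lam_recursion : kappa_recursion k lam.
Proof.
split=> [phi|n phi].
  apply: (linear_on_hspan (subspT _) lam_linear) => //.
    by move=> c f g _ _; apply: linearP.
  by move=> _ [w /= /size0nil -> <-]; apply: lam_vac.
have lL : linear_on (grade n) lam by move=> c f g _ _; apply: lam_linear.
have sG : subsp (@grade R H n) by apply: subsp_hspan.
have sT : subsp (tensS (@crF R H) (grade n)) by apply: subsp_hspan.
have lT : linear_on (tensS (@crF R H) (grade n)) lam.
  by move=> c f g _ _; apply: lam_linear.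
have inE phi' : tensS (@crF R H) (grade n) phi' -> E (idt (@crF R H) (grade n) lam phi').
  move=> hphi; apply: Ekap_tensS.
  by apply: (idt_tensS (@crF_dot R H) sG lL) => // Y _; apply: lam_Dadj.
have kT : linear_on (tensS (@crF R H) (grade n)) (k \o idt (@crF R H) (grade n) lam).
  move=> c f g hf hg /=; rewrite (idt_linear_on (@crF_dot R H) sG lL c hf hg).
  exact: kappa_linear (inE f hf) (inE g hg).
apply: (linear_on_hspan sT lT kT) => _ [[//|x w] [wn] <-].
  by rewrite -crF_tens; apply: tensS_cr; rewrite -wn; apply: grade_tens.
rewrite lam_cons -crF_tens [RHS]/=.
by rewrite (idt_tensor (@crF_dot R H) sG lL) // -wn; apply: grade_tens.
Qed.

Lemma grade_words n (phi : fock H) : grade n phi ->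
  exists2 s : seq (C * seq H), (forall p, p \in s -> size p.2 = n) &
    phi = \sum_(p <- s) p.1 *: tens p.2.
Proof.
case=> s hs ->; elim: s hs => [|[c psi] s IH] hs.
  by exists [::]; rewrite ?big_nil.
have [t ht Et] : exists2 t : seq (C * seq H), (forall p, p \in t -> size p.2 = n) &
    \sum_(p <- s) p.1 *: p.2 = \sum_(p <- t) p.1 *: tens p.2.
  by apply: IH => p ps; apply: hs; rewrite inE ps orbT.
have [w wn wE] := hs _ (mem_head _ _).
exists ((c, w) :: t); last by rewrite !big_cons Et wE.
by move=> p; rewrite inE => /predU1P[->|/ht].
Qed.

(** Reading a word w as u ++ v with j letters in v, the first j factors have
    already turned v into lambda v. The next factor acts on the last letter x of
    u and sends x (x) lambda v to lambda (x :: v) by [lam_cons]. Stated for sums,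
    since the factors are linear only on the subspaces [tensn]. *)
Lemma kprod_words n j (s : seq (C * seq H)) : (j <= n)%N ->
  (forall p, p \in s -> size p.2 = n) ->
  kprod xi k n j (embed (\sum_(p <- s) p.1 *: tens p.2)) =
  \sum_(p <- s) p.1 *:
    foldr (@crK R H) (lam (tens (drop (n - j) p.2))) (take (n - j) p.2).
Proof.
move=> jn hs; elim: j jn => [|j IH] jn.
  have -> : embed (\sum_(p <- s) p.1 *: tens p.2) =
      \sum_(p <- s) p.1 *: embed (tens p.2).
    by rewrite linear_sum; apply: eq_bigr => p _; apply: linearZ.
  rewrite subn0; apply: eq_big_seq => p /hs <-.
  by rewrite embed_tens drop_size take_size -lam_vac.
rewrite [LHS]/= IH 1?ltnW //; set m := (n - j.+1)%N.
have -> : (n - j)%N = m.+1 by rewrite /m subnSK.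
have sS : subsp (homog E j.+1) by apply: subspI subsp_Ekap (subsp_gradeK _ _).
have kL : linear_on (homog E j.+1) k.
  by move=> c f g [hf _] [hg _]; apply: kappa_linear.
(* [x] is the last letter of u, which moves to the front of v. *)
have wE p : p \in s -> exists x,
    [/\ take m.+1 p.2 = rcons (take m p.2) x, drop m p.2 = x :: drop m.+1 p.2,
        size (take m p.2) = m & size (drop m.+1 p.2) = j].
  move=> /hs pn; have mn : (m < size p.2)%N by rewrite pn /m ltn_subrL /= (leq_trans _ jn).
  exists (nth 0 p.2 m); split; [exact: take_nth | exact: drop_nth | |].
    by rewrite size_take mn.
  by rewrite size_drop pn /m subnSK // subKn // ltnW.
have hS p : p \in s -> homog E j.+1 (crK (head 0 (drop m p.2)) (lam (tens (drop m.+1 p.2)))).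
  move=> /wE[x [_ _ _ sj]]; split; first exact/Ekap_crK/lam_Dadj.
  by apply/gradeK_crK/lam_grade; rewrite -{1}sj; apply: grade_tens.
have E1 p : p \in s ->
    foldr (@crK R H) (lam (tens (drop m.+1 p.2))) (take m.+1 p.2) =
    foldr (@crK R H) (crK (head 0 (drop m p.2)) (lam (tens (drop m.+1 p.2)))) (take m p.2).
  by move=> /wE[x [-> -> _ _]]; rewrite foldr_rcons.
have hT p : p \in s -> tensn m (homog E j.+1)
    (foldr (@crK R H) (lam (tens (drop m.+1 p.2))) (take m.+1 p.2)).
  move=> ps; rewrite E1 //; have [x [_ _ sm _]] := wE p ps.
  by have := tensn_foldr (take m p.2) (hS p ps); rewrite sm.
rewrite (linear_on_sum (subsp_tensn sS m) (idtn_linear_on sS kL (n := m))); last first.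
  by move=> p /hT; apply: subspZ (subsp_tensn sS m).
apply: eq_big_seq => p ps.
rewrite (linear_onZ (subsp_tensn sS m) (idtn_linear_on sS kL (n := m))); last exact: hT.
rewrite E1 //; congr (_ *: _); have [x [_ dE sm _]] := wE p ps.
have := idtn_foldr sS kL (take m p.2) (hS p ps); rewrite sm => ->.
by congr foldr; rewrite dE lam_cons.
Qed.

Lemma lam_product : kappa_product xi k lam.
Proof.
move=> n phi n0 /grade_words[s hs ->]; rewrite kprod_words // subnn.
rewrite (linear_on_sum (subspT _) lam_linear) //; apply: eq_bigr => p _.
by rewrite drop0 take0 (linear_onZ (subspT _) lam_linear).
Qed.

Lemma kappa_product_eq l : linear_on [set: fock H] l -> l (vac H) = om ->
  kappa_product xi k l -> l =1 lam.
Proof.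
move=> lL lv lp; apply: (eq_lam lL) => // x w _.
by rewrite (lp (size w).+1) -?lam_product //; apply: (grade_tens (x :: w)).
Qed.

End WithKappa.
End Kappa.

(** * Transport of operators along the embedding *)

Section Conjugation.
Variables (R : realType) (H : preHilbertType R) (I : interacting_fock H).
Variable xi : {linear I -> fullfock H}.
Hypothesis xiP : fock_isometry xi.
Local Notation C := R[i].
Local Notation K := (fullfock H).
Local Notation D := (Dadj xi).
Local Notation Phi a := (xi \o a \o adj xi).

Lemma conj_Lin (a : I -> I) : linear_on [set: I] a -> Lin D D (Phi a).
Proof.
move=> aL; split=> [c x y hx hy|x _]; last exact: Dadj_xi.
by rewrite /= (adj_linear xiP) // aL // linearP.
Qed.

(** Multiplicativity and injectivity both come from xi^* xi = id. *)
Lemma conj_alg_mono : alg_mono xi (fun a : I -> I => Phi a).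
Proof.
split=> [a|c a b Y _|a b Y _|a b ab X]; first by apply: conj_Lin => c X Y _ _; apply: linearP.
- by rewrite /= linearP.
- by rewrite /= (adj_xi xiP).
apply: (xi_inj xiP); have := ab (xi X); rewrite /= (adj_xi xiP); apply.
by rewrite inE; apply: Dadj_xi.
Qed.

Lemma conj_adjoint (a b : I -> I) :
  is_adjoint [set: I] [set: I] a b -> is_adjoint D D (Phi a) (Phi b).
Proof.
case=> -[aL _] [bL _] ab; split=> [||x y Dx Dy]; [exact: conj_Lin | exact: conj_Lin |].
rewrite /= (adj_dot xiP) // ab // [RHS]dotJ (adj_dot xiP) //.
by rewrite -dotJ.
Qed.

Lemma eq_adjoint (f f' g : K -> K) :
  {in D, f =1 f'} -> is_adjoint D D f g -> is_adjoint D D f' g.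
Proof.
move=> ff [[fL fD] gP fg]; have E x : D x -> f' x = f x.
  by move=> Dx; rewrite ff // inE.
split=> //; last by move=> x y Dx Dy; rewrite E // fg.
split=> [c x y Dx Dy|x Dx]; last by rewrite E //; apply: fD.
by rewrite !E ?fL //; apply: (subsp_Dadj xi).2.
Qed.

Lemma conj_vacuum (a : {linear I -> I}) :
  '[vacK H, Phi a (vacK H)] = '[ivac I, a (ivac I)].
Proof. by rewrite /= (adj_vac xiP) -(xi_vac xiP) (xi_dot xiP). Qed.

End Conjugation.

(** * A map kappa without adjoint *)

(* The standard inner product of C^n. *)
HB.instance Definition _ (R : realType) n :=
  isPreHilbert.Build R 'rV[R[i]]_n (@dotmx R[i] n : {dot _ for conjC}).

Section NonAdjointable.
Variable R : realType.
Local Notation C := R[i].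
Local Notation V := 'rV[C]_2.
Local Notation H := (fock V).

Definition basis2 (i : 'I_2) : V := delta_mx 0 i.

Lemma rV2_dot (u v : V) : '[u, v] = u 0 0 * (v 0 0)^* + u 0 1 * (v 0 1)^*.
Proof.
rewrite [LHS]dotmxE mxE !big_ord_recl big_ord0 addr0 !mxE.
by rewrite (_ : lift _ _ = 1) //; apply: val_inj.
Qed.

Lemma basis2_dot i j : '[basis2 i, basis2 j] = (i == j)%:R.
Proof.
rewrite rV2_dot !mxE; case: i => [[|[|?]] ?] //; case: j => [[|[|?]] ?] //=;
 rewrite ?conjC1 ?conjC0 /=; ring.
Qed.

Lemma rV2E (Y : V) : Y = Y 0 0 *: basis2 0 + Y 0 1 *: basis2 1.
Proof.
apply/rowP => i; rewrite !mxE; case: i => [[|[|?]] ?] //=;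
  rewrite mulr1 mulr0 ?addr0 ?add0r; congr (Y 0 _); exact: val_inj.
Qed.

Lemma prod_multi : multilinear (Z := C^o) (fun w : seq V => \prod_(x <- w) (x : V) 0 0).
Proof.
move=> u v c x y; rewrite !big_cat !big_cons /= !mxE /GRing.scale /=; ring.
Qed.

(** If [fock V] is seen as noncommutative polynomials, this is the evaluation
    that sends every x to its first coordinate, so it is 1 on all powers of the
    first basis vector. *)
Definition coeff_sum : H -> C^o := Defs.lift (fun w : seq V => \prod_(x <- w) (x : V) 0 0).

Lemma coeff_sum_linear : linear coeff_sum.
Proof. exact: lift_linear prod_multi. Qed.

Lemma coeff_sum_tens w : coeff_sum (tens w) = \prod_(x <- w) (x : V) 0 0.
Proof. exact: lift_tens prod_multi. Qed.

Lemma coeff_sum_vac : coeff_sum (vac V) = 1.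
Proof. by rewrite coeff_sum_tens big_nil. Qed.

(** A vector of [fock V] has bounded degree, so it is orthogonal to high powers
    of the first basis vector, on which the functional is 1. *)
Lemma coeff_sum_nonrep : ~ exists h : H, forall x, coeff_sum x = '[x, h].
Proof.
case=> h hP; have [s E] := fockP h.
pose n := (\max_(p <- s) size p.2).+1.
have := hP (tens (nseq n (basis2 0))).
rewrite coeff_sum_tens big_nseq mxE eqxx -Monoid.iteropE.
rewrite E dot_sumr big1_seq => [|p /= ps].
  have -> : iterop n *%R (1 : C) 1 = 1 by exact: expr1n.
  by move/eqP; rewrite oner_eq0.
rewrite dotZr tens_dot kdot_size ?mulr0 //.
rewrite /= size_nseq gtn_eqF // ltnS.
exact: (leq_bigmax_seq (F := fun p : C * seq V => size p.2)).
Qed.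

(** Degree n is spanned by the basis vector number n; so it is 0 from n = 2 on. *)
Definition two_deg n : set V := [set Y | forall i : 'I_2, i != n :> nat -> Y 0 i = 0].

(** The creation operators a^*(x) Omega = phi(x) v, a^*(x) v = 0, for the
    functional phi = [coeff_sum]. *)
Definition two_cr (x : H) (Y : V) : V := (coeff_sum x * Y 0 0) *: basis2 1.

Fact two_cr_bilinear : bilinear_for
  (GRing.Scale.Law.clone _ _ *:%R _) (GRing.Scale.Law.clone _ _ *:%R _) two_cr.
Proof.
split=> [Y c x y|x c Y Z].
  rewrite /= /two_cr coeff_sum_linear scalerA -scalerDl; congr (_ *: _).
  by rewrite /GRing.scale /=; ring.
rewrite /= /two_cr !mxE scalerA -scalerDl; congr (_ *: _); ring.
Qed.
HB.instance Definition _ :=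
  bilinear_isBilinear.Build C H V V _ _ two_cr two_cr_bilinear.

Fact two_vac_unit : '[basis2 0, basis2 0] = 1.
Proof. by rewrite basis2_dot. Qed.

Fact two_deg0 : two_deg 0 = [set c *: basis2 0 | c in [set: C]].
Proof.
apply/seteqP; split=> [Y Y0|_ [c _ <-] i i0].
  by exists (Y 0 0) => //; rewrite [RHS]rV2E (Y0 1) // scale0r addr0.
rewrite !mxE eqxx /= (_ : i == 0 = false) ?mulr0 //.
by apply/eqP => E; move: i0; rewrite E.
Qed.

Fact two_deg_ortho m n X Y : m <> n -> two_deg m X -> two_deg n Y -> '[X, Y] = 0.
Proof.
move=> mn hX hY; rewrite rV2_dot.
suff h (i : 'I_2) : X 0 i * (Y 0 i)^* = 0 by rewrite !h addr0.
have [im|im] := eqVneq (i : nat) m; last by rewrite hX ?mul0r.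
by rewrite (hY i) ?conjC0 ?mulr0 // im; apply/eqP.
Qed.

Fact two_deg_sum X : exists N (Y : nat -> V),
  (forall n, two_deg n (Y n)) /\ X = \sum_(n < N) Y n.
Proof.
exists 2%N, (fun n => \row_(i < 2) if i == n :> nat then X 0 i else 0).
split=> [n i /negPf ni|]; first by rewrite mxE ni.
rewrite !big_ord_recl big_ord0 addr0; apply/rowP => i; rewrite !mxE.
by case: i => [[|[|?]] ?] //=; rewrite ?addr0 ?add0r.
Qed.

Fact two_cr_span n :
  two_deg n.+1 = hspan [set two_cr x X | x in [set: H] & X in two_deg n].
Proof.
apply/seteqP; split=> [Y hY|].
  have Y0 : Y 0 0 = 0 by apply: hY.
  case: n hY => [|n] hY; last first.
    by rewrite [Y]rV2E Y0 (hY 1) // !scale0r addr0; apply: hspan0.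
  apply: hspan_sub; exists (Y 0 1 *: vac V) => //; exists (basis2 0).
    by rewrite two_deg0; exists 1; rewrite ?scale1r.
  rewrite [RHS]rV2E Y0 scale0r add0r /two_cr !mxE /= mulr1; congr (_ *: _).
  have := coeff_sum_linear (Y 0 1) (vac V) 0.
  have -> : coeff_sum 0 = 0.
    by have := coeff_sum_linear (-1) 0 0; rewrite !scaleN1r !addNr.
  by rewrite !addr0 coeff_sum_vac => ->; apply: mulr1.
apply: hspan_min; first split=> [i _|c X Y hX hY i ni].
- by rewrite mxE.
- by rewrite !mxE hX // hY // mulr0 addr0.
move=> _ [x _ [X hX <-]] i ni; rewrite !mxE eqxx /=.
have [i1|_] := eqVneq i 1; last by rewrite mulr0.
by rewrite (hX 0) ?mulr0 ?mul0r //; move: ni; rewrite i1 eqSS eq_sym.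
Qed.

Definition two_fock : interacting_fock H :=
  @InteractingFock R H V (basis2 0) two_deg two_cr two_vac_unit two_deg0
    two_deg_ortho two_deg_sum two_cr_span.

(** Any unit vector of H can serve as the image of v; here it is the vacuum of
    H, viewed as a word of length one. *)
Definition two_xi (Y : V) : fullfock H :=
  Y 0 0 *: vacK H + Y 0 1 *: embed (tens [:: vac V]).

Fact two_xi_linear : linear two_xi.
Proof.
move=> c Y Z; rewrite /two_xi !mxE; move: (vacK H) (embed _) => f g.
by rewrite !scalerDl scalerDr !scalerA addrACA.
Qed.
HB.instance Definition _ :=
  GRing.isLinear.Build C two_fock (fullfock H) _ two_xi two_xi_linear.

(** The adjoint of a^*(x), which sends v to the conjugate of phi(x) times Omega. *)
Definition two_ann (x : H) (Y : V) : V := ((coeff_sum x)^* * Y 0 1) *: basis2 0.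

Fact two_ann_linear x : linear (two_ann x).
Proof.
move=> c Y Z; rewrite /two_ann !mxE scalerA -scalerDl; congr (_ *: _); ring.
Qed.
HB.instance Definition _ x :=
  GRing.isLinear.Build C two_fock two_fock _ (two_ann x) (two_ann_linear x).

Lemma two_xi_isometry : fock_isometry (two_xi : {linear two_fock -> fullfock H}).
Proof.
have o : '[vacK H, embed (tens [:: vac V])] = 0.
  by rewrite embed_dot tens_dot.
have u : '[embed (tens [:: vac V]) : fullfock H, embed (tens [:: vac V])] = 1.
  by rewrite embed_dot tens_dot /= mulr1 tens_dot.
split=> [X Y||n X hX].
- rewrite [RHS]rV2_dot /= /two_xi; move: (vacK H) (embed _) (vacK_unit H) o u.
  move=> f g fu o u; rewrite dotDl !dotDr !dotZl !dotZr fu u o dotJ o conjC0.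
  by rewrite !mulr0 !mulr1 addr0 add0r.
- rewrite -[LHS]/(two_xi (basis2 0)) /two_xi !mxE; move: (vacK H) (embed _) => f g.
  by rewrite /= scale1r scale0r addr0.
have sG := subsp_gradeK H n.
have part (i : 'I_2) (Z : fullfock H) : gradeK i Z -> gradeK n (X 0 i *: Z).
  have [ni hZ|ni _] := eqVneq (i : nat) n.
    by rewrite -ni; apply: subspZ (subsp_gradeK H i) hZ.
  by rewrite (hX i ni) scale0r; apply: sG.1.
apply: subspD sG (part 0 _ (gradeK_vac H)) (part 1 _ _).
exact: gradeK_embed (grade_tens [:: vac V]).
Qed.

Lemma two_ann_adjoint x :
  is_adjoint [set: two_fock] [set: two_fock] (icr two_fock x) (two_ann x).
Proof.
split.
- by split=> // c X Y _ _; apply: linearP.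
- by split=> // c X Y _ _; apply: linearP.
move=> X Y _ _; rewrite /= rV2_dot [RHS]rV2_dot !mxE /=.
by rewrite !(mulr0, mulr1, conjC0, mul0r, add0r, addr0) rmorphM /= conjCK; ring.
Qed.

(** Pairing an alleged k'(xi v), a finite sum of tensors p_1 (x) p_2 plus a
    multiple of Omega, with x (x) Omega exhibits the vector of H that would
    represent the functional. *)
Lemma two_kappa_not_adjointable k :
  is_kappa (two_xi : {linear two_fock -> fullfock H}) k ->
  ~ exists k', is_adjoint (Ekap (two_xi : {linear two_fock -> fullfock H}))
                 (Dadj (two_xi : {linear two_fock -> fullfock H})) k k'.
Proof.
move=> kP [k' [_ [_ k'E] kk']]; apply: coeff_sum_nonrep.
set xi : {linear two_fock -> fullfock H} := two_xi in kP k'E kk'.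
have xiP : fock_isometry xi := two_xi_isometry.
have Dv : Dadj xi (vacK H) := Dadj_vac xiP.
have [Z hZ [c _ E]] := k'E _ (Dadj_xi xi (basis2 1)).
have [s hs ZE] := tensSP hZ.
exists (\sum_(p <- s) '[p.2, vacK H] *: p.1) => x.
have : '[k (crK x (vacK H)), xi (basis2 1)] = coeff_sum x.
  rewrite (kappa_crK kP) // (adj_vac xiP) (xi_dot xiP) dotZl basis2_dot !mxE.
  by rewrite !mulr1.
move=> <-; rewrite kk'; [|exact: Ekap_crK|exact: Dadj_xi].
rewrite -E dotDr dotZr [X in _ + _ * X]dotJ crK_vac conjC0 mulr0 addr0 ZE.
rewrite !dot_sumr; apply: eq_bigr => p _.
by rewrite crK_dot dotZr -dotJ mulrC.
Qed.

End NonAdjointable.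

Theorem theorem4p3 (R : realType) :
  (forall (H : preHilbertType R) (I : interacting_fock H)
          (xi : {linear I -> fullfock H}),
    fock_isometry xi ->
    let D := Dadj xi in
    let E := Ekap xi in
    let Phi := fun a : I -> I => xi \o a \o adj xi in
    let lam := xi \o @Lam R H I in
    exists kappa : fullfock H -> fullfock H,
      [/\ is_kappa xi kappa,
          forall kappa', is_kappa xi kappa' -> {in E, kappa' =1 kappa} &
          fock_map (vacK H) (homog E) (vacK H) (homog D) kappa] /\
      [/\ alg_mono xi Phi &
          forall x, {in D, Phi (icr I x) =1 kappa \o crK x}] /\
      (forall (x : H) (ax : {linear I -> I}),
        is_adjoint [set: I] [set: I] (icr I x) ax ->
        is_adjoint D D (kappa \o crK x) (Phi ax)) /\
      (forall a b : {linear I -> I},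
        is_adjoint [set: I] [set: I] a b -> is_adjoint D D (Phi a) (Phi b)) /\
      (forall a : {linear I -> I},
        '[vacK H, Phi a (vacK H)] = '[ivac I, a (ivac I)]) /\
      [/\ Lin [set: fock H] D lam,
          fock_map (vac H) (@grade R H) (vacK H) (homog D) lam &
          forall l : fock H -> fullfock H,
            Lin [set: fock H] D l ->
            fock_map (vac H) (@grade R H) (vacK H) (homog D) l ->
            [/\ kappa_fixpoint kappa l <-> l =1 lam,
                kappa_recursion kappa l <-> l =1 lam &
                kappa_product xi kappa l <-> l =1 lam]]) /\
  (exists (H : preHilbertType R) (I : interacting_fock H)
          (xi : {linear I -> fullfock H}),
    [/\ fock_isometry xi,
        forall x, exists ax : {linear I -> I},
          is_adjoint [set: I] [set: I] (icr I x) ax &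
        forall kappa, is_kappa xi kappa ->
          ~ exists kappa', is_adjoint (Ekap xi) (Dadj xi) kappa kappa']).

Proof.
split=> [H I xi xiP D E Phi lam|]; last first.
  exists (fock 'rV[R[i]]_2), (two_fock R).
  exists (@two_xi R : {linear two_fock R -> fullfock (fock 'rV[R[i]]_2)}).
  split; [exact: two_xi_isometry | | exact: two_kappa_not_adjointable].
  move=> x; exists (two_ann x : {linear two_fock R -> two_fock R}).
  exact: two_ann_adjoint.
have [k kP] := kappa_exists xiP; exists k.
have kE x : {in D, Phi (icr I x) =1 k \o crK x}.
  by move=> Y; rewrite inE => DY; rewrite /= (kappa_crK kP).
split.
  split; [exact: kP | exact: kappa_unique kP | ].
  split=> [|n Z [EZ gZ]]; first exact: kappa_vac kP.
  by have DkZ := kappa_Dadj kP EZ; have gkZ := kappa_grade xiP kP EZ gZ; split.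
split; first by split=> //; exact: conj_alg_mono.
split.
  by move=> x ax h; apply: eq_adjoint (kE x) (conj_adjoint xiP h).
split; first by move=> a b; apply: conj_adjoint.
split; first exact: conj_vacuum.
split.
- by split=> [|phi _]; [exact: lam_linear | exact: lam_Dadj].
- split=> [|n phi gphi]; first exact: lam_vac.
  by have Dl := lam_Dadj xi phi; have gl := lam_grade xiP gphi; split.
move=> l [lL lD] [lv _]; have {}lD phi : D (l phi) by apply: lD.
have to_lam : l =1 lam -> l = lam by move=> /funext.
split; split=> [h|/to_lam ->].
- exact: (kappa_fixpoint_eq xiP kP lL).
- exact: (lam_fixpoint xiP kP).
- exact: (kappa_recursion_eq xiP kP lL).
- exact: (lam_recursion xiP kP).
- exact: (kappa_product_eq xiP kP lL lv).
- exact: (lam_product xiP kP).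
Qed.
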